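(* Let $R$ be a real closed field and $M\subset R^n$ a semialgebraic set. Assume that $M$ is $2$-dimensional and the germ $M_q$ is semialgebraically connected for all $q\in\mathrm{Cl}(M)$. Then for each semialgebraic function $f\in\mathcal{S}(M,R)$ there exists an open semialgebraic neighborhood $V$ of $M$ in $\mathrm{Cl}(M)$ such that $f$ can be extended continuously to $V$.
   Context: $R^n$ carries the (Euclidean) order topology and $\mathrm{Cl}$ denotes closure in $R^n$. $\mathcal{S}(M,R)$ is the ring of semialgebraic functions on $M$, i.e. continuous functions $f:M\to R$ whose graph is semialgebraic. For a semialgebraic set $S$ and a point $q$, $S_q$ denotes the germ of $S$ at $q$. The germ $S_q$ is semialgebraically connected if $q$ has arbitrarily small open semialgebraic neighborhoods $W$ with $S\cap W$ semialgebraically connected. *)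

(* Defs.v *)
(* MathComp / MathComp-Analysis.  Only the canonical structures of multinomials'
   mpoly are imported: its notations clash with those of MathComp-Analysis. *)
From mathcomp Require Import all_boot all_order all_algebra.
From mathcomp Require Import ring_quotient.
From mathcomp Require Import boolp classical_sets topology normedtype.
From mathcomp Require mpoly.
Import (canonicals) mpoly.

Set Implicit Arguments.
Unset Strict Implicit.
Unset Printing Implicit Defensive.

Import Order.TTheory GRing.Theory Num.Theory.
Import numFieldNormedType.Exports.

Local Open Scope classical_set_scope.
Local Open Scope ring_scope.

(* R^n is 'rV[R]_n.  Its library topology is the product of n copies of the
   topology of R given by the balls `|x - y| < e with e > 0 in R, that is, of
   the order topology of R. *)

Definition mpeval (R : rcfType) (n : nat) (p : mpoly.mpoly n R) (x : 'rV[R]_n) : R :=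
  mpoly.meval (fun i => x ord0 i) p.

(* {p = 0} is the complement of {p > 0} `|` {- p > 0}. *)
Inductive semialgebraic (R : rcfType) (n : nat) : set 'rV[R]_n -> Prop :=
| semialgebraic_pos (p : mpoly.mpoly n R) :
    semialgebraic [set x | 0 < mpeval p x]
| semialgebraic_setU (A B : set 'rV[R]_n) :
    semialgebraic A -> semialgebraic B -> semialgebraic (A `|` B)
| semialgebraic_setI (A B : set 'rV[R]_n) :
    semialgebraic A -> semialgebraic B -> semialgebraic (A `&` B)
| semialgebraic_setC (A : set 'rV[R]_n) :
    semialgebraic A -> semialgebraic (~` A).

Definition graph_on (R : rcfType) (n : nat) (M : set 'rV[R]_n) (f : 'rV[R]_n -> R) :
    set 'rV[R]_(n + 1) :=
  [set row_mx x (f x)%:M | x in M].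

(* Membership in S(M, R): only the values of f on M matter. *)
Definition semialgebraic_fun (R : rcfType) (n : nat) (M : set 'rV[R]_n)
    (f : 'rV[R]_n -> R) : Prop :=
  {within M, continuous f} /\ semialgebraic (graph_on M f).

Definition open_in (T : topologicalType) (A B : set T) : Prop :=
  exists2 U : set T, open U & B = A `&` U.

Definition semialgebraically_connected (R : rcfType) (n : nat)
    (S : set 'rV[R]_n) : Prop :=
  forall A B : set 'rV[R]_n,
    semialgebraic A -> semialgebraic B ->
    open_in S A -> open_in S B ->
    A `&` B = set0 -> A `|` B = S ->
    A = set0 \/ B = set0.

Definition germ_semialgebraically_connected (R : rcfType) (n : nat)
    (S : set 'rV[R]_n) (q : 'rV[R]_n) : Prop :=
  forall U : set 'rV[R]_n, nbhs q U ->
    exists W : set 'rV[R]_n,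
      [/\ open W, semialgebraic W, W q, W `<=` U &
          semialgebraically_connected (S `&` W)].

Definition vanishing_ideal (R : rcfType) (n : nat) (M : set 'rV[R]_n) :
    set (mpoly.mpoly n R) :=
  [set p | forall x, M x -> mpeval p x = 0].

(* c 0 < c 1 < ... < c d are prime ideals of A containing I, i.e. a chain of
   length d of primes of A / I.  The library's [idealr_closed] includes that the
   ideal is proper. *)
Definition prime_chain (A : comNzRingType) (I : set A) (d : nat)
    (c : 'I_d.+1 -> {pred A}) : Prop :=
  [/\ forall i, idealr_closed (c i) /\ prime_idealr_closed (c i),
      forall i a, I a -> a \in c i &
      forall i j : 'I_d.+1, (i < j)%N ->
        {subset c i <= c j} /\ exists2 a, a \in c j & a \notin c i].

(* The Krull dimension of A / I is d. *)
Definition krull_dim_quot (A : comNzRingType) (I : set A) (d : nat) : Prop :=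
  (exists c : 'I_d.+1 -> {pred A}, prime_chain I c) /\
  (forall (e : nat) (c : 'I_e.+1 -> {pred A}), prime_chain I c -> (e <= d)%N).

(* dim M is the dimension of the Zariski closure of M, i.e. the Krull dimension
   of the ring of polynomial functions on M. *)
Definition semialgebraic_dim (R : rcfType) (n : nat) (M : set 'rV[R]_n)
    (d : nat) : Prop :=
  krull_dim_quot (vanishing_ideal M) d.

(* Main.v *)
Require Import Defs.
From HB Require Import structures.
From mathcomp Require Import all_boot all_order all_algebra.
From mathcomp Require Import ring_quotient lra.
From mathcomp Require Import boolp classical_sets topology normedtype.
From mathcomp Require mpoly complex qe_rcf ordered_qelim.
Import -(notations) mpoly.
Import (canonicals) complex.
Import Order.TTheory GRing.Theory Num.Theory.
Import numFieldNormedType.Exports.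
Set Implicit Arguments.
Unset Strict Implicit.
Unset Printing Implicit Defensive.
Local Open Scope classical_set_scope.
Local Open Scope ring_scope.

(** Call [q] in [Cl M \ M] bad if [f] has no limit at [q].  It suffices to see that
    near a point of [M] there are only finitely many bad points, since [f] extends
    by its limits elsewhere.

    Algebra.  For a coordinate [x_i] and a polynomial [G], the functions
    [x_i, f, G] on [M] satisfy a nonzero polynomial relation [P = 0].  Otherwise an
    ultrafilter on [M] avoids the zero sets of all such relations, and the
    polynomials in [x_1, ..., x_n, f, G] vanishing on a large set form a prime
    ideal modulo which [f, x_i, G] are algebraically independent.  Extend them by
    coordinates to a transcendence basis; specializing [f], [x_i] and [G]
    successively to generic constants gives three strict specializations of this
    prime.  As [f] is algebraic over the coordinates, the inclusions remain strict
    in the ring of polynomials in [x_1, ..., x_n] (the norm of [f - c] takes the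
    place of [f - c]), contradicting [dim M = 2].

    Geometry.  Dividing [P] by a power of the last variable gives [Q] with
    [Q(s, y, 0)] nonzero and [Q(x_i, f, G) = 0] on [M] where [G <> 0].  Let [G] run
    through the polynomials defining [M].  If [q] is not in [M], each [x] in [M]
    near [q] satisfies [G(q) = 0 <> G(x)] for one of them, so [Q(q_i, f(x), 0)] is
    small as long as [f] is bounded near [q].  If [Q(q_i, y, 0)] is a nonzero
    polynomial in [y] for all [G], the values of [f] near [q] thus accumulate at
    its roots only, and at a single root because the germ of [M] at [q] is
    connected.  Hence the coordinates of a bad point near which [f] is bounded lie
    in finite sets. *)

Local Notation mX i := (mpolyX _ (mnm1 i)).

(** * Polynomial rings and prime ideals *)

(** The substitution identities below are all checked through this, on constants and on
    variables. *)
Lemma mpoly_rmorph_ext n (R S : comNzRingType) (f g : {rmorphism mpoly n R -> S}) :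
  (forall c, f (mpolyC n c) = g (mpolyC n c)) ->
  (forall i, f (mX i) = g (mX i)) -> f =1 g.
Proof.
move=> eqC eqX; elim/mpolyind => [|c m p _ _ IH]; first by rewrite !rmorph0.
rewrite -mul_mpolyC !rmorphD !rmorphM /= IH eqC; congr (_ * _ + _).
by rewrite mpolyXE_id !rmorph_prod; apply: eq_bigr => i _; rewrite !rmorphXn /= eqX.
Qed.

Lemma mmapXU n (R S : nzRingType) (f : {rmorphism R -> S}) (h : 'I_n -> S) i :
  mmap f h (mX i) = h i.
Proof. by rewrite mmapX mmap1U. Qed.

(** Ideals are handled as kernels of morphisms, so that congruences become equations between values
    of [pi]. *)
Lemma ideal_kernel (A : comNzRingType) (q : {pred A}) : idealr_closed q ->
  exists (K : comNzRingType) (pi : {rmorphism A -> K}), forall u, (pi u == 0) = (u \in q).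
Proof.
move=> qid.
pose I0 := isIdealr.Build A q qid.
pose I : idealr A := HB.pack q I0.
exists {ideal_quot I}.
have h0 : zmod_morphism (\pi_({ideal_quot I})%qT : A -> {ideal_quot I}).
  by move=> x y /=; rewrite !piE.
have h1 : monoid_morphism (\pi_({ideal_quot I})%qT : A -> {ideal_quot I}).
  by split => [|x y]; rewrite ?piE.
pose f0 := GRing.isZmodMorphism.Build A {ideal_quot I} _ h0.
pose f1 := GRing.isMonoidMorphism.Build A {ideal_quot I} _ h1.
pose pi : {rmorphism A -> {ideal_quot I}} :=
  HB.pack (\pi_({ideal_quot I})%qT : A -> {ideal_quot I}) f0 f1.
exists pi => u; rewrite /pi /= .
have -> : 0 = \pi_({ideal_quot I})%qT 0 :> {ideal_quot I} by rewrite piE.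
by rewrite -Quotient.idealrBE subr0.
Qed.

(** An ideal maximal among those that contain [I] and miss the multiplicative set [S] is prime;
    Zorn's lemma provides one. *)
Lemma prime_avoidance (A : comNzRingType) (I S : set A) :
  I 0 -> (forall a u v, I u -> I v -> I (a * u + v)) ->
  S 1 -> (forall u v, S u -> S v -> S (u * v)) -> (forall u, I u -> ~ S u) ->
  exists (K : comNzRingType) (pi : {rmorphism A -> K}),
   [/\ forall u v, pi (u * v) = 0 -> pi u = 0 \/ pi v = 0,
       forall u, I u -> pi u = 0 & forall u, S u -> pi u <> 0].
Proof.
move=> I0 Icl S1 SM IS.
(* Only a nonempty [X] is required to contain [I]: the union of the empty chain is empty and must
   satisfy [P] too. *)
pose P (X : set A) := [/\ forall a u v, X u -> X v -> X (a * u + v),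
  forall u, X u -> ~ S u & X !=set0 -> I `<=` X].
have [F FP Ftot|X [[Xcl XS XI] Xmax]] := @Zorn_bigcup A P.
  split.
  - move=> a u v [X FX Xu] [Y FY Yv].
    have [XY|YX] := Ftot _ _ FX FY.
      by exists Y => //; case: (FP _ FY) => + _ _; apply => //; apply: XY.
    by exists X => //; case: (FP _ FX) => + _ _; apply => //; apply: YX.
  - by move=> u [X FX Xu]; case: (FP _ FX) => _ + _; apply.
  - move=> [u [X FX Xu]] v Iv; exists X => //.
    by case: (FP _ FX) => _ _; apply => //; exists u.
have X0 : X !=set0.
  apply/set0P/eqP => X0; apply: (Xmax I); last first.
    by rewrite /P; split => // u.
  by rewrite X0 properEneq; split=> //; apply/eqP => /esym h; rewrite h in I0.
have {}XI := XI X0.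
have Xz : X 0 by apply: XI.
have XM a u : X u -> X (a * u) by move=> Xu; rewrite -[_ * _]addr0; apply: Xcl.
have XD u v : X u -> X v -> X (u + v) by move=> Xu Xv; rewrite -[u]mul1r; apply: Xcl.
(* By maximality, the ideal generated by [X] and an element outside [X] meets [S]. *)
have key u : ~ X u -> exists a x, X x /\ S (a * u + x).
  move=> Xu; pose B := [set w | exists a x, X x /\ w = a * u + x].
  have XB : X `<=` B by move=> x Xx; exists 0, x; rewrite mul0r add0r.
  have Bu : B u by exists 1, 0; rewrite mul1r addr0.
  apply: contrapT => nS; apply: (Xmax B).
    by split => // BX; apply: Xu; apply: BX.
  split.
  - move=> a _ _ [b [x [Xx ->]]] [c [y [Xy ->]]].
    exists (a * b + c), (a * x + y); split; first exact: Xcl.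
    by rewrite mulrDr mulrDl !mulrA addrACA.
  - by move=> w [a [x [Xx ->]]] Sw; apply: nS; exists a, x.
  - by move=> _; apply: subset_trans XI XB.
have Xprime u v : X (u * v) -> X u \/ X v.
  move=> Xuv; apply: contrapT => /not_orP[/key[a [x [Xx Sx]]] /key[b [y [Xy Sy]]]].
  apply: (XS _ _ (SM _ _ Sx Sy)).
  rewrite mulrDl; apply: (XD); last by rewrite mulrC; apply: (XM).
  rewrite mulrDr; apply: (XD); last exact: (XM).
  by rewrite mulrACA; apply: XM.
have qid : idealr_closed [pred u | `[< X u >]].
  split; first by apply/asboolP.
    by apply/negP => /asboolP /XS; apply.
  by move=> a u v /asboolP Xu /asboolP Xv; apply/asboolP; apply: (Xcl).
have [K [pi piE]] := ideal_kernel qid; exists K, pi.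
have {}piE u : pi u = 0 <-> X u.
  by split=> [/eqP|Xu]; [rewrite piE => /asboolP|apply/eqP; rewrite piE; apply/asboolP].
split=> [u v|u|u].
- by rewrite !piE; apply: Xprime.
- by rewrite piE; apply: XI.
- by move=> Su /piE /XS; apply.
Qed.

(** * Specializing a transcendence basis *)

Section Restriction.
Variables (R : idomainType) (N : nat).
Local Notation A := (mpoly N R).

(** The retraction onto the polynomials in the variables of [J]. The equation [restr J P = P]
    expresses that only these variables occur in [P], so no separate ring in fewer variables is
    needed. *)
Definition restr (J : {set 'I_N}) : A -> A :=
  mmap (@mpolyC N R) (fun i => if i \in J then mX i else 0).
HB.instance Definition _ J := GRing.RMorphism.copy (restr J) (restr J).

Definition spec (i : 'I_N) (c : R) : A -> A :=
  mmap (@mpolyC N R) (fun j => if j == i then mpolyC N c else mX j).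
HB.instance Definition _ i c := GRing.RMorphism.copy (spec i c) (spec i c).

Lemma restrC J c : restr J (mpolyC N c) = mpolyC N c.
Proof. exact: mmapC. Qed.

Lemma restrX (J : {set 'I_N}) i : restr J (mX i) = if i \in J then mX i else 0.
Proof. exact: mmapXU. Qed.

Lemma specC i c d : spec i c (mpolyC N d) = mpolyC N d.
Proof. exact: mmapC. Qed.

Lemma specX i c j : spec i c (mX j) = if j == i then mpolyC N c else mX j.
Proof. exact: mmapXU. Qed.

Lemma restr_restr (J J' : {set 'I_N}) P : restr J (restr J' P) = restr (J :&: J') P.
Proof.
move: P; apply: (mpoly_rmorph_ext (f := restr J \o restr J') (g := restr (J :&: J'))).
  by move=> c /=; rewrite !restrC.
move=> i /=; rewrite !restrX inE andbC.
by case: (i \in J') => /=; rewrite ?restrX ?rmorph0.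
Qed.

Lemma spec_restr (i : 'I_N) c (J : {set 'I_N}) P :
  spec i c (restr (J :\ i) P) = restr (J :\ i) P.
Proof.
move: P; apply: (mpoly_rmorph_ext (f := spec i c \o restr (J :\ i)) (g := restr (J :\ i))).
  by move=> d /=; rewrite !restrC specC.
move=> j /=; rewrite !restrX !inE.
by have [->|ji] /= := eqVneq j i; rewrite ?rmorph0 //; case: (j \in J);
  rewrite ?rmorph0 // specX (negPf ji).
Qed.

Lemma restr_spec (i : 'I_N) c (J : {set 'I_N}) P :
  restr (J :\ i) (spec i c (restr J P)) = spec i c (restr J P).
Proof.
move: P; apply: (mpoly_rmorph_ext (f := restr (J :\ i) \o (spec i c \o restr J))
   (g := spec i c \o restr J)).
  by move=> d /=; rewrite !(restrC, specC).
move=> j /=; rewrite !restrX; case: (boolP (j \in J)) => jJ; last by rewrite !rmorph0.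
rewrite specX; have [_|ji] /= := eqVneq j i; first by rewrite restrC.
by rewrite restrX !inE ji jJ.
Qed.

(** The kernel of [pi] is prime, the variables of [J] are independent modulo it, and once the
    nonzero [a], a polynomial in these variables, is inverted, the quotient is integral over the
    polynomials in [J]. Multiplying by powers of [a] avoids localizing. *)
Definition normalization (K : comNzRingType) (pi : {rmorphism A -> K})
    (J : {set 'I_N}) (a : A) : Prop :=
  [/\ forall u v, pi (u * v) = 0 -> pi u = 0 \/ pi v = 0,
      forall P, restr J P = P -> pi P = 0 -> P = 0,
      restr J a = a, a != 0 &
      forall h, exists D, integralOver (pi \o restr J) (pi (a ^+ D * h))].

(** The elements that become integral after multiplication by a power of [a] form a ring containing
    the constants, so the variables decide. *)
Lemma integral_generators (K : comNzRingType) (pi : {rmorphism A -> K})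
    (J : {set 'I_N}) (a : A) : restr J a = a ->
  (forall i, exists D, integralOver (pi \o restr J) (pi (a ^+ D * mX i))) ->
  forall h, exists D, integralOver (pi \o restr J) (pi (a ^+ D * h)).
Proof.
move=> aJ Hi.
have inta D : integralOver (pi \o restr J) (pi (a ^+ D)).
  have <- : (pi \o restr J) (a ^+ D) = pi (a ^+ D) by rewrite /= rmorphXn /= aJ.
  exact: integral_id.
pose T h := exists D, integralOver (pi \o restr J) (pi (a ^+ D * h)).
have TD u v : T u -> T v -> T (u + v).
  move=> [D uD] [E vE]; exists (D + E)%N.
  have -> : a ^+ (D + E) * (u + v) = a ^+ E * (a ^+ D * u) + a ^+ D * (a ^+ E * v).
    by rewrite mulrDr exprD !mulrA [a ^+ E * _]mulrC.
  by rewrite rmorphD; apply: integral_add; rewrite rmorphM; apply: integral_mul.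
have TM u v : T u -> T v -> T (u * v).
  move=> [D uD] [E vE]; exists (D + E)%N.
  by rewrite exprD mulrACA rmorphM; apply: integral_mul.
have TC c : T (mpolyC N c).
  exists 0%N; rewrite expr0 mul1r.
  have <- : (pi \o restr J) (mpolyC N c) = pi (mpolyC N c) by rewrite /= restrC.
  exact: integral_id.
have T1 : T 1 by rewrite -mpolyC1.
have TX i k : T (mX i ^+ k).
  by elim: k => [|k IH]; rewrite ?expr0 // exprS; apply: (TM) => //; apply: Hi.
move=> h; elim/mpolyind: h => [|c m p _ _ IH]; first by rewrite -mpolyC0; apply: (TC).
rewrite -mul_mpolyC; apply: (TD) => //; apply: (TM) => //.
by rewrite mpolyXE_id; apply: (big_ind T T1 TM) => i _; apply: TX.
Qed.

(** Consequently a morphism that kills [X_i - c] does not distinguish [P] from [spec i c P]. *)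
Lemma specB_factor (i : 'I_N) c P : exists Q, P - spec i c P = (mX i - mpolyC N c) * Q.
Proof.
elim/mpolyind: P => [|c' m p _ _ [Q IH]]; first by exists 0; rewrite rmorph0 subr0 mulr0.
pose T P := exists Q, P - spec i c P = (mX i - mpolyC N c) * Q.
have TM u v : T u -> T v -> T (u * v).
  move=> [q e] [r e']; exists (q * v + spec i c u * r).
  rewrite rmorphM mulrDr mulrA -e mulrCA -e' mulrBl mulrBr.
  by rewrite addrA subrK.
have TC d : T (mpolyC N d) by exists 0; rewrite specC subrr mulr0.
have TX j : T (mX j).
  rewrite /T specX; have [->|ji] := eqVneq j i; first by exists 1; rewrite mulr1.
  by exists 0; rewrite subrr mulr0.
have [Q' e'] : T (mpolyC N c' * mpolyX R m).
  apply: (TM) => //; rewrite mpolyXE_id; apply: (big_ind T _ TM) => [|j _].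
    by rewrite -mpolyC1; apply: (TC).
  elim: (m j) => [|k IHk]; first by rewrite expr0 -mpolyC1; apply: (TC).
  by rewrite exprS; apply: (TM).
exists (Q' + Q); rewrite -mul_mpolyC rmorphD mulrDr -e' -IH.
by rewrite opprD addrACA.
Qed.

(** The ideal generated by the kernel of [pi] and [t = X_i - c] contains no nonzero polynomial in
    the remaining variables of [J]. Hence a prime contains this ideal and keeps those variables
    independent, and integral equations survive the substitution of [c] for [X_i]. *)
Lemma normalization_step (K : comNzRingType) (pi : {rmorphism A -> K})
    (J : {set 'I_N}) (a : A) (i : 'I_N) (c : R) :
  normalization pi J a -> i \in J -> spec i c a != 0 ->
  exists (K' : comNzRingType) (pi' : {rmorphism A -> K'}),
   [/\ forall u, pi u = 0 -> pi' u = 0, pi' (mX i - mpolyC N c) = 0 &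
       normalization pi' (J :\ i) (spec i c a)].
Proof.
move=> [piP piJ aJ a0 aint] iJ b0; set b := spec i c a.
set t := mX i - mpolyC N c.
pose I := [set u | exists h, pi (u - t * h) = 0].
pose S := [set s : A | restr (J :\ i) s = s /\ s != 0].
have bJ : restr (J :\ i) b = b by rewrite /b -{1}aJ restr_spec aJ.
have tJ : restr J t = t by rewrite rmorphB /= restrX restrC iJ.
have st : spec i c t = 0 by rewrite rmorphB /= specX specC eqxx subrr.
have IS u : I u -> ~ S u.
  move=> [h uh] [uJ u0].
  have [D [p pmon]] := aint h.
  rewrite rootE => /eqP pr.
  have pu : pi u = pi t * pi h.
    by apply/eqP; rewrite -subr_eq0 -rmorphM -rmorphB uh.
  set q := map_poly (restr J) p; set d := (size p).-1.
  have qmon : q \is monic by apply: monic_map.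
  have sq : size q = d.+1 by rewrite size_map_poly_id0 ?prednK ?size_poly_gt0 ?monic_neq0 //
    (monicP pmon) rmorph1 oner_neq0.
  (* Modulo the kernel [u] is [t * h], so [Z] is the integral equation of [a ^+ D * h] multiplied by
     [t ^+ d]. In this form it involves only the variables of [J], which are independent. *)
  pose Z := \sum_(k < d.+1) q`_k * t ^+ (d - k) * (a ^+ D * u) ^+ k.
  have Z0 : pi Z = 0.
    rewrite rmorph_sum /=.
    transitivity (\sum_(k < d.+1) (pi t) ^+ d * (pi q`_k * (pi (a ^+ D * h)) ^+ k)).
      apply: eq_bigr => k _; rewrite !(rmorphM, rmorphXn) /= pu.
      have -> : pi t ^+ d = pi t ^+ (d - k) * pi t ^+ k.
        by rewrite -exprD subnK // -ltnS.
      rewrite mulrCA [pi a ^+ D * pi h in RHS]mulrC.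
      rewrite [pi a ^+ D * pi h]mulrC !exprMn.
      by rewrite !mulrA -[pi q`_k * _ * _]mulrA [pi q`_k * _]mulrC.
    rewrite -mulr_sumr -[RHS](mulr0 (pi t ^+ d)) -[in RHS]pr.
    congr (_ * _); rewrite map_poly_comp -/q horner_poly sq.
    by [].
  have ZJ : restr J Z = Z.
    have uJ' : restr J u = u.
      by rewrite -uJ restr_restr; congr (restr _ u); apply/finset.setIidPr; exact: finset.subD1set.
    rewrite rmorph_sum; apply: eq_bigr => k _ /=.
    by rewrite !(rmorphM, rmorphXn) /= aJ tJ uJ' coef_map /= restr_restr finset.setIid.
  (* Substituting [c] for [X_i] kills [t]; only the monic top term [(b ^+ D * u) ^+ d] remains, and
     it is nonzero. *)
  have /(congr1 (spec i c)) := piJ _ ZJ Z0.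
  rewrite rmorph0 rmorph_sum /= big_ord_recr /= big1 ?add0r => [|k _]; last first.
    rewrite !(rmorphM, rmorphXn) /= st expr0n subn_eq0 leqNgt ltn_ord /=.
    by rewrite mulr0 mul0r.
  rewrite subnn expr0 mulr1 !(rmorphM, rmorphXn) /= -/b.
  have -> : q`_d = 1 by rewrite -(monicP qmon) /lead_coef sq.
  rewrite rmorph1 mul1r -uJ spec_restr uJ => /eqP.
  by rewrite expf_eq0 mulf_eq0 expf_eq0 (negPf b0) (negPf u0) !andbF.
have [|d u v [h uh] [k vk]|||K' [pi' [piP' piI piS]]] := @prime_avoidance A I S _ _ _ _ IS.
- by exists 0; rewrite mulr0 subr0 rmorph0.
- exists (d * h + k); rewrite mulrDr opprD addrACA mulrCA -mulrBr.
  by rewrite rmorphD rmorphM uh vk mulr0 addr0.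
- by split; rewrite ?rmorph1 ?oner_neq0.
- by move=> u v [uJ u0] [vJ v0]; split; rewrite ?mulf_neq0 // rmorphM /= uJ vJ.
have pipi u : pi u = 0 -> pi' u = 0.
  by move=> u0; apply: piI; exists 0; rewrite mulr0 subr0.
have pit : pi' t = 0 by apply: piI; exists 1; rewrite mulr1 subrr rmorph0.
exists K', pi'; split => //.
have pispec P : pi' (spec i c P) = pi' P.
  have [Q e] := specB_factor i c P; apply/eqP.
  by rewrite eq_sym -subr_eq0 -rmorphB e rmorphM pit mul0r.
split=> // [P PJ P0|h].
  by apply/eqP/negPn/negP => Pn; apply: (piS P).
(* The integral equation over [J] is turned into one over [J :\ i] by specializing its
   coefficients. *)
have [D [p pmon pr]] := aint h; exists D.
exists (map_poly (spec i c \o restr J) p); first exact: monic_map.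
have eq1 : pi' (b ^+ D * h) = pi' (a ^+ D * h).
  by rewrite !rmorphM !rmorphXn /= pispec.
rewrite eq1 -map_poly_comp.
have -> : map_poly ((pi' \o restr (J :\ i)) \o (spec i c \o restr J)) p
  = map_poly (pi' \o restr J) p.
  by apply: eq_map_poly => x /=; rewrite restr_spec pispec.
move: pr; rewrite !rootE !map_poly_comp !horner_map => /eqP pr.
by apply/eqP; apply: pipi.
Qed.

End Restriction.

(** Finiteness as a bound on the length of duplicate-free lists, the form in which roots of a
    polynomial are counted. Generic constants are chosen outside such sets. *)
Definition few (R : eqType) (Q : R -> Prop) : Prop :=
  exists D : nat, forall rs : seq R, uniq rs -> (forall c, c \in rs -> Q c) -> (size rs < D)%N.

Lemma few_or (R : eqType) (Q1 Q2 : R -> Prop) : few Q1 -> few Q2 -> few (fun c => Q1 c \/ Q2 c).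
Proof.
move=> [D1 h1] [D2 h2]; exists (D1 + D2)%N => rs urs Qrs.
rewrite -(count_predC (fun c => `[< Q1 c >]) rs) -!size_filter.
have lt1 : (size [seq c <- rs | `[< Q1 c >]] < D1)%N.
  by apply: h1 => [|c]; rewrite ?filter_uniq // mem_filter => /andP[/asboolP].
have lt2 : (size [seq c <- rs | predC (fun c => `[< Q1 c >]) c] < D2)%N.
  apply: h2 => [|c]; rewrite ?filter_uniq // mem_filter => /andP[/= /asboolPn nQ crs].
  by case: (Qrs c crs).
by apply: leq_trans (leq_add lt1 lt2); rewrite addSn addnS !ltnS leqnSn.
Qed.

Lemma fewPn (R : numDomainType) (Q : R -> Prop) : few Q -> exists c, ~ Q c.
Proof.
move=> [D h]; apply: contrapT => nex.
have : (size [seq i%:R : R | i <- iota 0 D] < D)%N; last by rewrite size_map size_iota ltnn.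
apply: h => [|c _].
  by rewrite map_inj_uniq ?iota_uniq // => i j /eqP; rewrite eqr_nat => /eqP.
by apply: contrapT => nQ; apply: nex; exists c.
Qed.

Lemma few_roots (R : idomainType) (S : idomainType) (f : {rmorphism R -> S}) (p : {poly S}) :
  injective f -> p != 0 -> few (fun c => p.[f c] = 0).
Proof.
move=> finj p0; exists (size p) => rs urs prs.
rewrite -(size_map f); apply: max_poly_roots => //.
  by apply/allP => _ /mapP[c crs ->]; rewrite rootE prs.
by rewrite map_inj_uniq.
Qed.

(** * Existence of normalizations *)

Section Normalization.
Variables (R : idomainType) (N : nat).
Local Notation A := (mpoly N R).

(** A polynomial in [X_i] and the variables of [J], read as univariate in [X_i] with coefficients in
    the variables of [J]. *)
Definition as_poly (i : 'I_N) (J : {set 'I_N}) : A -> {poly A} :=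
  mmap (polyC \o @mpolyC N R)
    (fun j => if j == i then 'X else if j \in J then (mX j)%:P else 0).
HB.instance Definition _ i J := GRing.RMorphism.copy (as_poly i J) (as_poly i J).

Lemma as_polyC i J c : as_poly i J (mpolyC N c) = (mpolyC N c)%:P.
Proof. exact: mmapC. Qed.

Lemma as_polyX i (J : {set 'I_N}) j :
  as_poly i J (mX j) = if j == i then 'X else if j \in J then (mX j)%:P else 0.
Proof. exact: mmapXU. Qed.

Lemma as_polyK i (J : {set 'I_N}) P : (as_poly i J P).[mX i] = restr (i |: J)%SET P.
Proof.
move: P; apply: (mpoly_rmorph_ext (f := horner_eval (mX i) \o as_poly i J)
  (g := restr (i |: J)%SET)).
  by move=> c /=; rewrite as_polyC restrC /horner_eval hornerC.
move=> j /=; rewrite as_polyX restrX /horner_eval !inE.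
by have [->|ji] /= := eqVneq j i; rewrite ?hornerX //; case: ifP; rewrite ?hornerC ?horner0.
Qed.

Lemma spec_as_poly i c (J : {set 'I_N}) P : i \notin J ->
  (as_poly i J P).[mpolyC N c] = spec i c (restr (i |: J)%SET P).
Proof.
move=> iJ; move: P; apply: (mpoly_rmorph_ext (f := horner_eval (mpolyC N c) \o as_poly i J)
  (g := spec i c \o restr (i |: J)%SET)).
  by move=> d /=; rewrite as_polyC restrC specC /horner_eval hornerC.
move=> j /=; rewrite as_polyX restrX /horner_eval !inE.
have [->|ji] /= := eqVneq j i; first by rewrite specX eqxx hornerX.
by case: ifP; rewrite ?hornerC ?horner0 ?rmorph0 // specX (negPf ji).
Qed.

Lemma coef_as_poly i (J : {set 'I_N}) P k : restr J (as_poly i J P)`_k = (as_poly i J P)`_k.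
Proof.
suff <- : map_poly (restr J) (as_poly i J P) = as_poly i J P.
  by rewrite coef_map /= restr_restr finset.setIid.
move: P; apply: (mpoly_rmorph_ext (f := map_poly (restr J) \o as_poly i J) (g := as_poly i J)).
  by move=> c /=; rewrite as_polyC map_polyC /= restrC.
move=> j /=; rewrite as_polyX; have [ji|ji] := eqVneq j i; first by rewrite map_polyX.
by case: ifP => jJ; rewrite ?rmorph0 // map_polyC /= restrX jJ.
Qed.

Lemma few_spec0 (i : 'I_N) (J : {set 'I_N}) (P : A) :
  i \in J -> restr J P = P -> P != 0 -> few (fun c => spec i c P = 0).
Proof.
move=> iJ PJ P0.
have eJ : (i |: (J :\ i))%SET = J by exact: finset.setD1K.
have iJ' : i \notin J :\ i by rewrite !inE eqxx.
have p0 : as_poly i (J :\ i) P != 0.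
  by apply: contra_neq P0 => p0; rewrite -PJ -eJ -as_polyK p0 horner0.
have [D h] := few_roots (f := @mpolyC N R) (can_inj (@mpolyCK _ _)) p0.
exists D => rs urs rsP; apply: h => // c /rsP.
by rewrite spec_as_poly // eJ PJ.
Qed.

(** If [p] has degree [d + 1] and leading coefficient [r], then [r ^+ d * p.[u]] is a monic
    polynomial in [r * u]. *)
Lemma algebraic_integral (K : comNzRingType) (pi : {rmorphism A -> K}) (J : {set 'I_N})
    (u : A) (p : {poly A}) :
  (forall P, restr J P = P -> pi P = 0 -> P = 0) ->
  (forall k, restr J p`_k = p`_k) -> p != 0 -> pi p.[u] = 0 ->
  integralOver (pi \o restr J) (pi (lead_coef p * u)).
Proof.
move=> indep pJ p0 pu; set r := lead_coef p.
(* A constant [p] would be a nonzero polynomial in the variables of [J] killed by [pi]. *)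
have s2 : (1 < size p)%N.
  rewrite ltnNge; apply/negP => /size1_polyC pE.
  move: pu; rewrite pE hornerC => /(indep _ (pJ 0%N)) c0.
  by move: p0; rewrite pE c0 eqxx.
have [d sp] : exists d, size p = d.+2 by exists (size p).-2; case: (size p) s2 => [|[]].
have rE : r = p`_d.+1 by rewrite /r /lead_coef sp.
pose q := \poly_(k < d.+2) (if k == d.+1 then 1 else p`_k * r ^+ (d - k)).
have qlead : q`_d.+1 = 1 by rewrite coef_poly ltnS leqnn eqxx.
have sq : size q = d.+2 by apply: size_poly_eq; rewrite eqxx oner_neq0.
exists q; first by rewrite monicE /lead_coef sq qlead.
have qJ : map_poly (restr J) q = q.
  apply/polyP => k; rewrite coef_map /= /q coef_poly; case: ifP => _; last by rewrite rmorph0.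
  by case: ifP => _; rewrite ?rmorph1 // rmorphM rmorphXn /= pJ rE pJ.
rewrite map_poly_comp qJ rootE horner_map.
suff -> : q.[r * u] = r ^+ d * p.[u] by rewrite rmorphM pu mulr0.
rewrite horner_poly horner_coef sp mulr_sumr; apply: eq_bigr => k _.
have [->|kd] := eqVneq (k : nat) d.+1; first by rewrite mul1r -rE exprMn exprSr mulrA.
have kd' : (k <= d)%N by rewrite -ltnS ltn_neqAle kd -ltnS ltn_ord.
have -> : r ^+ d = r ^+ (d - k) * r ^+ k by rewrite -exprD subnK.
by rewrite exprMn [RHS]mulrACA [p`_k * _]mulrC.
Qed.

(** Take [J] maximal independent above [J0]. Every other variable satisfies an equation over [J],
    and [a] is the product of the leading coefficients. *)
Lemma normalization_exists (K : comNzRingType) (pi : {rmorphism A -> K}) (J0 : {set 'I_N}) :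
  (forall u v, pi (u * v) = 0 -> pi u = 0 \/ pi v = 0) ->
  (forall P, restr J0 P = P -> pi P = 0 -> P = 0) ->
  exists (J : {set 'I_N}) (a : A), J0 \subset J /\ normalization pi J a.
Proof.
move=> piP indep0.
pose indep (J : {set 'I_N}) := `[< forall P, restr J P = P -> pi P = 0 -> P = 0 >].
have [J /maxsetP[/asboolP Ji Jmax] J0J] : {J | maxset indep J & J0 \subset J}.
  by apply: maxset_exists; apply/asboolP.
have rex j : exists r, [/\ r != 0, restr J r = r & integralOver (pi \o restr J) (pi (r * mX j))].
  have [jJ|jJ] := boolP (j \in J).
    exists 1; rewrite oner_neq0 rmorph1 mul1r; split => //.
    have <- : (pi \o restr J) (mX j) = pi (mX j) by rewrite /= restrX jJ.
    exact: integral_id.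
  have : ~ (forall P, restr (j |: J)%SET P = P -> pi P = 0 -> P = 0).
    move=> Jj; have := Jmax (j |: J)%SET; rewrite /indep asboolT // finset.subsetU1 => /(_ isT isT).
    by move=> e; move: jJ; rewrite -e finset.setU11.
  move=> /existsNP[P /not_implyP[PJ /not_implyP[P0 /eqP Pn]]].
  have p0 : as_poly j J P != 0.
    by apply: contra_neq Pn => p0; rewrite -PJ -as_polyK p0 horner0.
  exists (lead_coef (as_poly j J P)); split; first by rewrite lead_coef_eq0.
    exact: coef_as_poly.
  apply: algebraic_integral => //; first exact: coef_as_poly.
  by rewrite as_polyK PJ.
have [r rP] := choice rex.
exists J, (\prod_j r j); split => //; split => //.
- by rewrite rmorph_prod; apply: eq_bigr => j _; case: (rP j).
- by apply/prodf_neq0 => j _; case: (rP j).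
apply: integral_generators => [|j].
  by rewrite rmorph_prod; apply: eq_bigr => k _; case: (rP k).
exists 1%N; rewrite expr1 (bigD1 j) //= mulrAC rmorphM; apply: integral_mul.
  by case: (rP j).
set b := (X in pi X).
have <- : (pi \o restr J) b = pi b.
  by rewrite /= rmorph_prod; congr (pi _); apply: eq_bigr => k _; case: (rP k).
exact: integral_id.
Qed.

End Normalization.

(** Three normalization steps, each with a constant at which the current denominator does not
    vanish. The inclusions are strict because a variable not yet specialized is still
    independent. *)
Lemma three_specializations (R : numFieldType) (N : nat) (K : comNzRingType)
    (pi : {rmorphism mpoly N R -> K}) (i1 i2 i3 : 'I_N) (B : R -> Prop) :
  i1 != i2 -> i1 != i3 -> i2 != i3 ->
  (forall u v, pi (u * v) = 0 -> pi u = 0 \/ pi v = 0) ->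
  (forall P, restr [set i1; i2; i3]%SET P = P -> pi P = 0 -> P = 0) ->
  few B ->
  exists (c1 c2 c3 : R) (K1 K2 K3 : comNzRingType) (pi1 : {rmorphism mpoly N R -> K1})
    (pi2 : {rmorphism mpoly N R -> K2}) (pi3 : {rmorphism mpoly N R -> K3}),
  [/\ [/\ forall u v, pi1 (u * v) = 0 -> pi1 u = 0 \/ pi1 v = 0,
      forall u v, pi2 (u * v) = 0 -> pi2 u = 0 \/ pi2 v = 0 &
      forall u v, pi3 (u * v) = 0 -> pi3 u = 0 \/ pi3 v = 0],
    [/\ forall u, pi u = 0 -> pi1 u = 0, forall u, pi1 u = 0 -> pi2 u = 0 &
        forall u, pi2 u = 0 -> pi3 u = 0],
    ~ B c1 /\ pi1 (mX i1 - mpolyC N c1) = 0,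
    pi2 (mX i2 - mpolyC N c2) = 0 /\ pi1 (mX i2 - mpolyC N c2) <> 0 &
    pi3 (mX i3 - mpolyC N c3) = 0 /\ pi2 (mX i3 - mpolyC N c3) <> 0].
Proof.
move=> n12 n13 n23 piP indep fB.
have [J [a [J0J nrm]]] := normalization_exists piP indep.
have [j1 j2 j3] : [/\ i1 \in J, i2 \in J & i3 \in J].
  by split; apply: (fintype.subsetP J0J); rewrite !inE eqxx ?orbT.
have avoid (J' : {set 'I_N}) (K' : comNzRingType) (pi' : {rmorphism mpoly N R -> K'}) a' i B' :
  normalization pi' J' a' -> i \in J' -> few B' -> exists c, ~ B' c /\ spec i c a' != 0.
  move=> [_ _ aJ a0 _] iJ fB'.
  have [c /not_orP[h1 /eqP h2]] := fewPn (few_or fB' (few_spec0 iJ aJ a0)).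
  by exists c.
have few0 : few (fun _ : R => False).
  by exists 1%N => -[//|c rs] _ /(_ c); rewrite mem_head => /(_ isT).
have nz (J' : {set 'I_N}) (K' : comNzRingType) (pi' : {rmorphism mpoly N R -> K'}) a' i c :
  normalization pi' J' a' -> i \in J' -> pi' (mX i - mpolyC N c) <> 0.
  move=> [_ ind _ _ _] iJ /ind; rewrite rmorphB /= restrX iJ restrC => /(_ erefl).
  (* Substituting [c + 1] for the variable sends [X_i - c] to [1], so this polynomial is nonzero. *)
  move=> /(congr1 (spec i (c + 1))); rewrite rmorphB rmorph0 /= specX specC eqxx -mpolyCB.
  rewrite addrAC subrr add0r => /eqP; rewrite mpolyC_eq0.
  by rewrite oner_eq0.
have [c1 [nB a1]] := avoid _ _ _ _ _ _ nrm j1 fB.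
have [K1 [pi1 [p1 p1t nrm1]]] := normalization_step nrm j1 a1.
have j21 : i2 \in (J :\ i1)%SET by rewrite !inE eq_sym n12.
have [c2 [_ a2]] := avoid _ _ _ _ _ _ nrm1 j21 few0.
have [K2 [pi2 [p2 p2t nrm2]]] := normalization_step nrm1 j21 a2.
have j31 : i3 \in ((J :\ i1) :\ i2)%SET.
  by rewrite !inE ![i3 == _]eq_sym n13 n23.
have [c3 [_ a3]] := avoid _ _ _ _ _ _ nrm2 j31 few0.
have [K3 [pi3 [p3 p3t nrm3]]] := normalization_step nrm2 j31 a3.
exists c1, c2, c3, K1, K2, K3, pi1, pi2, pi3; split.
- by split; [case: nrm1|case: nrm2|case: nrm3].
- by [].
- by [].
- by split=> //; apply: nz nrm1 _.
- by split=> //; apply: nz nrm2 _.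
Qed.

(** * Algebraic dependence on a set of dimension 2 *)

Section LastVariable.
Variables (R : rcfType) (n : nat).

(** The last variable stands for the value coordinate of the graph. *)
Definition last_poly : mpoly (n + 1) R -> {poly mpoly n R} :=
  mmap (polyC \o @mpolyC n R)
    (fun i => if split i is inl j then (mX j)%:P else 'X).
HB.instance Definition _ := GRing.RMorphism.copy last_poly last_poly.

Lemma last_poly_eval (F : mpoly (n + 1) R) (x : 'rV[R]_n) (y : R) :
  (map_poly (meval (fun i => x ord0 i)) (last_poly F)).[y] = mpeval F (row_mx x y%:M).
Proof.
move: F; rewrite /mpeval.
apply: (mpoly_rmorph_ext (f := horner_eval y \o map_poly (meval (fun i => x ord0 i)) \o last_poly)
 (g := meval (fun i => row_mx x y%:M ord0 i))) => [c|i] /=.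
  by rewrite /last_poly mmapC /= map_polyC /= !mevalC /horner_eval hornerC.
rewrite /last_poly mmapXU mevalXU mxE; case: splitP => [j _|k _].
  by rewrite map_polyC /= mevalXU /horner_eval hornerC.
by rewrite map_polyX /horner_eval hornerX mxE [k]ord1 eqxx mulr1n.
Qed.

End LastVariable.

Section PrimeChains.
Variables (A : comNzRingType).

(** With the kernels increasing along all of [nat], strictness needs checking only between neighbors
    below [d]. *)
Lemma kernel_prime_chain (I : set A) (d : nat) (K : nat -> comNzRingType)
    (pi : forall k, {rmorphism A -> K k}) :
  (forall k u v, pi k (u * v) = 0 -> pi k u = 0 \/ pi k v = 0) ->
  (forall u, I u -> pi 0%N u = 0) ->
  (forall k u, pi k u = 0 -> pi k.+1 u = 0) ->
  (forall k, (k < d)%N -> exists u, pi k.+1 u = 0 /\ pi k u <> 0) ->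
  prime_chain I (fun k : 'I_d.+1 => [pred u | pi k u == 0]).
Proof.
move=> piP I0 mono strict.
have monoD i j u : pi i u = 0 -> pi (j + i)%N u = 0.
  by move=> u0; elim: j => // j IH; apply: mono.
have monoL i j u : (i <= j)%N -> pi i u = 0 -> pi j u = 0.
  by move=> ij u0; rewrite -(subnK ij); apply: monoD.
split.
- move=> k; split; last first.
    by move=> u v /eqP/piP[] h; rewrite !inE h eqxx ?orbT.
  split; rewrite ?inE ?rmorph0 ?rmorph1 ?oner_eq0 //.
  by move=> a u v /eqP u0 /eqP v0; rewrite inE rmorphD rmorphM u0 v0 mulr0 addr0.
- by move=> k a /I0 a0; rewrite inE; apply/eqP; apply: monoL a0.
- move=> i j ij; split.
    by move=> u /eqP u0; rewrite inE; apply/eqP; apply: monoL u0; apply: ltnW.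
  case: j ij => -[|j] //= jd; rewrite ltnS => ij.
  have [|u [u0 un]] := strict j; first by [].
  exists u; first by rewrite inE; apply/eqP.
  by rewrite inE; apply/eqP => /(monoL _ _ _ ij).
Qed.

End PrimeChains.

Section Dependence.
Variables (R : rcfType) (n : nat) (M : set 'rV[R]_n) (f : 'rV[R]_n -> R).

(** The outermost variable of [P] receives [z] and the innermost [s]; it is powers of the outermost
    one that are divided out later. *)
Definition eval3 (P : {poly {poly {poly R}}}) (s y z : R) : R :=
  P.[z%:P%:P].[y%:P].[s].

Local Notation N := (n + 2)%N.
Let vX (i : 'I_n) : 'I_N := lshift 2 i.
Let vY : 'I_N := rshift n ord0.
Let vZ : 'I_N := rshift n ord_max.

(** The list [Fs] expresses that [f] is algebraic over the coordinates, where different points of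
    [M] may use different members. The dimension enters as the bound 2 on chains of primes. *)
Lemma dim2_dependence (Fs : seq (mpoly (n + 1) R)) :
  (forall (e : nat) (c : 'I_e.+1 -> {pred mpoly n R}),
     prime_chain (vanishing_ideal M) c -> (e <= 2)%N) ->
  (forall x, M x -> exists2 F, F \in Fs &
     mpeval F (row_mx x (f x)%:M) = 0 /\ exists y, mpeval F (row_mx x y%:M) <> 0) ->
  forall (i : 'I_n) (G : mpoly n R),
  exists2 P, P != 0 & forall x, M x -> eval3 P (x ord0 i) (f x) (mpeval G x) = 0.
Proof.
move=> dimM Falg i G; apply: contrapT => indep.
pose val (x : 'rV[R]_n) (j : 'I_N) : R :=
  match split j with inl k => x ord0 k | inr k => if k == ord0 then f x else mpeval G x end.
have valX x k : val x (vX k) = x ord0 k.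
  by rewrite /val; case: splitP => [j /= e|j /= e];
    [congr (x _ _); exact/val_inj|move: (ltn_ord k); rewrite e ltnNge leq_addr].
have valY x : val x vY = f x.
  rewrite /val; case: splitP => [j /= e|j /= e].
    by move: (ltn_ord j); rewrite -e addn0 ltnn.
  by move/addnI: e => e; rewrite -val_eqE /= -e.
have valZ x : val x vZ = mpeval G x.
  rewrite /val; case: splitP => [j /= e|j /= e].
    by move: (ltn_ord j); rewrite -e ltnNge leq_addr.
  by move/addnI: e => e; rewrite -val_eqE /= -e.
have nYX : vY != vX i by rewrite -val_eqE /= addn0 gtn_eqF.
have nYZ : vY != vZ by rewrite -val_eqE /= eqn_add2l.
have nXZ : vX i != vZ by rewrite -val_eqE /= ltn_eqF // ltn_addr.
pose J := [set vY; vX i; vZ]%SET.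
have indepJ P : restr J P = P -> P != 0 -> ~ (forall x, M x -> meval (val x) P = 0).
  move=> PJ P0 Pval; apply: indep.
  (* [h] reads a polynomial in the three variables as a nested one, with [G] outermost and [x_i]
     innermost; [g] below translates back. *)
  pose h : mpoly N R -> {poly {poly {poly R}}} := mmap (polyC \o (polyC \o polyC))
    (fun j => if j == vY then 'X%:P else if j == vX i then 'X%:P%:P else
              if j == vZ then 'X else 0).
  exists (h P).
    apply: contra_neq P0 => hP0.
    pose g := horner_eval (mX (vX i) : mpoly N R) \o horner_eval (mX vY)%:P
      \o horner_eval (mX vZ)%:P%:P \o map_poly (map_poly (map_poly (@mpolyC N R))).
    suff gh : forall Q, g (h Q) = restr J Q.
      by rewrite -PJ -gh hP0 /g /= rmorph0 /horner_eval !horner0.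
    apply: (mpoly_rmorph_ext (f := g \o h) (g := restr J)) => [c|j] /=.
      by rewrite restrC mmapC /horner_eval /= map_polyC hornerC /= map_polyC hornerC /= map_polyC hornerC.
    rewrite restrX mmapXU /horner_eval !inE /=.
    have [->|jY] := eqVneq j vY.
      by rewrite /= map_polyC /= map_polyX hornerC hornerX hornerC.
    have [->|jX] := eqVneq j (vX i).
      by rewrite /= map_polyC /= map_polyC /= map_polyX !hornerC hornerX.
    have [->|jZ] := eqVneq j vZ; last by rewrite !rmorph0 !horner0.
    by rewrite /= map_polyX hornerX !hornerC.
  move=> x Mx.
  rewrite -[RHS](Pval x Mx) -[in RHS]PJ /eval3 -[x ord0 i]valX -valY -valZ.
  move: (P); apply: (mpoly_rmorph_ext
    (f := horner_eval (val x (vX i)) \o horner_eval (val x vY)%:P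
      \o horner_eval (val x vZ)%:P%:P \o h) (g := meval (val x) \o restr J)) => [c|j] /=.
    by rewrite restrC mmapC /horner_eval !hornerC mevalC.
  rewrite restrX mmapXU /horner_eval !inE /=.
  have [->|jY] := eqVneq j vY; first by rewrite /= hornerC hornerX hornerC mevalXU.
  have [->|jX] := eqVneq j (vX i); first by rewrite /= !hornerC hornerX mevalXU.
  have [->|jZ] := eqVneq j vZ; last by rewrite /= !horner0 meval0.
  by rewrite /= hornerX !hornerC mevalXU.
(* A filter generated by the complements in [M] of the zero sets of nonzero polynomials in [f],
   [x_i], [G]. Products give intersections; it is proper because none of these polynomials vanishes
   on [M]. *)
pose B := [set S : set 'rV[R]_n | exists P,
  [/\ restr J P = P, P != 0 & forall x, M x -> meval (val x) P <> 0 -> S x]].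
have BP : ProperFilter B.
  apply: Build_ProperFilter.
    move=> [P [PJ P0 PM]]; apply: (indepJ P PJ P0) => x Mx.
    by apply: contrapT => h; apply: (PM x).
  split.
  - by exists 1; rewrite rmorph1 oner_neq0.
  - move=> S T [P [PJ P0 PM]] [Q [QJ Q0 QM]]; exists (P * Q).
    split; [by rewrite rmorphM /= PJ QJ|by rewrite mulf_neq0|].
    move=> x Mx /eqP; rewrite rmorphM mulf_eq0 negb_or => /andP[/eqP h1 /eqP h2].
    by split; [apply: PM|apply: QM].
  - by move=> S T ST [P [PJ P0 PM]]; exists P; split => // x Mx h; apply/ST/PM.
have [U [UU BU]] := ultraFilterLemma BP.
have UM : U M by apply: BU; exists 1; split; rewrite ?rmorph1 ?oner_neq0.
pose q := [pred P | `[< U [set x | meval (val x) P = 0] >]].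
have qid : idealr_closed q.
  split.
  - by apply/asboolP; apply: filterS filterT => x _; apply: rmorph0.
  - apply/negP => /asboolP; rewrite (_ : [set x | _] = set0); first exact: filter_not_empty.
    by apply/seteqP; split => x //=; rewrite rmorph1 => /eqP; rewrite oner_eq0.
  - move=> a u v /asboolP Uu /asboolP Uv; apply/asboolP.
    apply: filterS2 Uu Uv => x /= u0 v0.
    by rewrite rmorphD rmorphM /= u0 v0 mulr0 addr0.
have [K0 [pi0 pi0E]] := ideal_kernel qid.
have {qid pi0E q} pi0P P : pi0 P = 0 <-> U [set x | meval (val x) P = 0].
  by split=> [/eqP|h]; [rewrite pi0E => /asboolP|apply/eqP; rewrite pi0E; apply/asboolP].
have pi0prime u v : pi0 (u * v) = 0 -> pi0 u = 0 \/ pi0 v = 0.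
  rewrite !pi0P => Uuv.
  have [|Uu] := in_ultra_setVsetC [set x | meval (val x) u = 0] UU; first by left.
  right; apply: filterS2 Uuv Uu => x /= /eqP; rewrite rmorphM mulf_eq0.
  by case/orP => /eqP.
have pi0J P : restr J P = P -> pi0 P = 0 -> P = 0.
  move=> PJ /pi0P UP; apply: contrapT => /eqP P0.
  have UnP : U [set x | meval (val x) P <> 0] by apply: BU; exists P.
  apply: (@filter_not_empty _ U).
  by apply: filterS2 UP UnP => x /= h1 h2.
(* An ultrafilter containing a finite union contains one of its members, so a single [F] serves on a
   large set. *)
have [F FFs UF] : exists2 F, F \in Fs & U [set x |
     mpeval F (row_mx x (f x)%:M) = 0 /\ exists y, mpeval F (row_mx x y%:M) <> 0].
  have {Falg} : U [set x | exists2 F, F \in Fs &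
     mpeval F (row_mx x (f x)%:M) = 0 /\ exists y, mpeval F (row_mx x y%:M) <> 0].
    by apply: filterS UM.
  elim: (Fs) => [|F Fs' IH] UFs.
    have := @filter_not_empty _ U _.
    by case; apply: filterS UFs => x /= [].
  have [UF|UF] := in_ultra_setVsetC [set x |
     mpeval F (row_mx x (f x)%:M) = 0 /\ exists y, mpeval F (row_mx x y%:M) <> 0] UU.
    by exists F => //; rewrite mem_head.
  have [|F' F'Fs UF'] := IH; last by exists F' => //; rewrite inE F'Fs orbT.
  apply: filterS2 UFs UF => x /= [F']; rewrite inE => /orP[/eqP-> //|F'Fs h _].
  by exists F'.
(* At a point common to the large sets involved, [F(x, _)] is a nonzero polynomial having all these
   [c] as roots. *)
have fewB : few (fun c => U [set x | mpeval F (row_mx x c%:M) = 0]).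
  exists (size (last_poly F)) => rs urs Urs.
  have : U [set x | forall c, c \in rs -> mpeval F (row_mx x c%:M) = 0].
    elim: rs Urs {urs} => [|c rs IH] Urs; first by apply: filterS filterT => x _ c.
    have h1 := Urs c (mem_head _ _).
    have h2 : U [set x | forall c, c \in rs -> mpeval F (row_mx x c%:M) = 0].
      by apply: IH => d drs; apply: Urs; rewrite inE drs orbT.
    apply: filterS2 h1 h2 => x /= e1 e2 d; rewrite inE => /orP[/eqP-> //|]; exact: e2.
  move=> Urs'; have [x [/= xrs [_ [y yn]]]] := filter_ex (filterI Urs' UF).
  pose p := map_poly (meval (fun i => x ord0 i)) (last_poly F).
  apply: (@leq_trans (size p)); last exact: size_poly.
  apply: max_poly_roots => //.
    by apply: contra_not_neq yn => p0; rewrite -last_poly_eval -/p p0 horner0.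
  by apply/allP => c crs; rewrite rootE last_poly_eval xrs.
have [c1 [c2 [c3 [K1 [K2 [K3 [pi1 [pi2 [pi3 [[p1 p2 p3] [m1 m2 m3] [nB1 t1] [t2 n2] [t3 n3]]]]]]]]]]]
  := three_specializations nYX nYZ nXZ pi0prime pi0J fewB.
(* The primes are pulled back along the inclusion of the polynomials in the coordinates alone. *)
pose theta : mpoly n R -> mpoly N R := mmap (@mpolyC N R) (fun j => mX (vX j)).
have thC c : theta (mpolyC n c) = mpolyC N c by exact: mmapC.
have thX j : theta (mX j) = mX (vX j) by exact: mmapXU.
have thval x u : meval (val x) (theta u) = mpeval u x.
  move: u; rewrite /mpeval; apply: (mpoly_rmorph_ext (f := meval (val x) \o theta)) => [c|j] /=.
    by rewrite mmapC !mevalC.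
  by rewrite mmapXU !mevalXU valX.
pose K k : comNzRingType := match k with 0%N => K0 | 1%N => K1 | 2%N => K2 | _ => K3 end.
pose pi k : {rmorphism mpoly N R -> K k} :=
  match k with 0%N => pi0 | 1%N => pi1 | 2%N => pi2 | _ => pi3 end.
suff chain : prime_chain (vanishing_ideal M)
    (fun k : 'I_4 => [pred u | (pi k \o theta) u == 0]) by have := dimM _ _ chain.
pose pith k : {rmorphism mpoly n R -> K k} := pi k \o theta.
apply: (@kernel_prime_chain _ _ 3 K pith).
- by case=> [|[|[|k]]] u v /=; rewrite rmorphM; [apply: pi0prime|apply: p1|apply: p2|apply: p3].
- move=> u uM /=; apply/pi0P; apply: filterS UM => x Mx /=.
  by rewrite thval; apply: uM.
- by case=> [|[|[|k]]] u //=; [apply: m1|apply: m2|apply: m3].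
case=> [|[|[|k]]] //= _.
(* [F(x, c1)] replaces [f - c1], which is not a polynomial in the coordinates. It lies in the second
   kernel because [F(x, f)] does and [f] is congruent to [c1] there; it is not in the first by the
   choice of [c1]. *)
- exists (last_poly F).[mpolyC n c1]; split; last first.
    move=> /pi0P h; apply: nB1; apply: filterS h => x /=.
    rewrite thval -last_poly_eval => <-.
    have -> : c1 = mpeval (mpolyC n c1) x by rewrite /mpeval mevalC.
    by rewrite /mpeval horner_map mevalC.
  pose th1 : mpoly (n + 1) R -> mpoly N R := mmap (@mpolyC N R)
    (fun j => if split j is inl k then mX (vX k) else mX vY).
  have th1F : pi0 (th1 F) = 0.
    apply/pi0P; apply: filterS UF => x /= [h _]; rewrite -[RHS]h.
    move: (F); rewrite /mpeval.
    apply: (mpoly_rmorph_ext (f := meval (val x) \o th1)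
      (g := meval (fun i0 => row_mx x (f x)%:M ord0 i0))) => [c|j] /=.
      by rewrite /th1 mmapC !mevalC.
    rewrite /th1 mmapXU mevalXU mxE; case: splitP => k _; rewrite mevalXU ?valX //.
    by rewrite valY mxE [k]ord1 eqxx mulr1n.
  have spF : theta (last_poly F).[mpolyC n c1] = spec vY c1 (th1 F).
    move: (F); apply: (mpoly_rmorph_ext (f := theta \o horner_eval (mpolyC n c1) \o @last_poly R n)
       (g := spec vY c1 \o th1)) => [c|j] /=.
      by rewrite /last_poly /th1 !mmapC /= /horner_eval hornerC mmapC specC.
    rewrite /last_poly /th1 !mmapXU /horner_eval; case: splitP => k _.
      by rewrite hornerC mmapXU specX -val_eqE /= addn0 ltn_eqF.
    by rewrite hornerX mmapC specX eqxx.
  change (pi1 (theta (last_poly F).[mpolyC n c1]) = 0).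
  rewrite spF; have [Q e] := specB_factor vY c1 (th1 F).
  have := congr1 pi1 e; rewrite rmorphB rmorphM /= t1 mul0r (m1 _ th1F) sub0r => /eqP.
  by rewrite oppr_eq0 => /eqP.
- exists (mX i - mpolyC n c2).
  change (pi2 (theta (mX i - mpolyC n c2)) = 0 /\ pi1 (theta (mX i - mpolyC n c2)) <> 0).
  have -> : theta (mX i - mpolyC n c2) = mX (vX i) - mpolyC N c2.
    by rewrite [LHS]rmorphB; congr (_ - _); [exact: thX|exact: thC].
  by split.
- exists (G - mpolyC n c3).
  (* The variable [vZ] takes the value of [G] at every point, so [vZ - theta G] lies in all the
     kernels and [G - c3] inherits the strictness. *)
  have ZG : pi0 (mX vZ - theta G) = 0.
    apply/pi0P; apply: filterS filterT => x _ /=.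
    by rewrite mevalB mevalXU valZ thval subrr.
  have ZG2 := m2 _ (m1 _ ZG); have ZG3 := m3 _ ZG2.
  have eZ : theta (G - mpolyC n c3) = (mX vZ - mpolyC N c3) - (mX vZ - theta G).
    have -> : theta (G - mpolyC n c3) = theta G - mpolyC N c3.
      by rewrite [LHS]rmorphB; congr (_ - _); exact: thC.
    by rewrite opprB [RHS]addrC addrA subrK.
  change (pi3 (theta (G - mpolyC n c3)) = 0 /\ pi2 (theta (G - mpolyC n c3)) <> 0).
  by rewrite eZ !rmorphB /= in ZG2 ZG3 n3 t3 *; rewrite ZG2 ZG3 !subr0.
Qed.

End Dependence.

(** * Semialgebraic sets *)

Module oq := ordered_qelim.ord.

Section Semialgebraic.
Variable R : rcfType.
Implicit Types (n m k l : nat).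

Lemma semialgebraic_ext n (A B : set 'rV[R]_n) :
  (forall x, A x <-> B x) -> semialgebraic A -> semialgebraic B.
Proof. by move=> AB; have -> : A = B by apply/seteqP; split => x /AB. Qed.

Lemma semialgebraicT n : semialgebraic (setT : set 'rV[R]_n).
Proof.
apply: semialgebraic_ext (semialgebraic_pos (1 : mpoly n R)) => x /=.
by rewrite /mpeval meval1 ltr01.
Qed.

Lemma semialgebraic_zero n (p : mpoly n R) : semialgebraic [set x | mpeval p x = 0].
Proof.
apply: semialgebraic_ext (semialgebraic_setC (semialgebraic_setU
  (semialgebraic_pos p) (semialgebraic_pos (- p)))) => x /=.
rewrite /mpeval mevalN oppr_gt0; split=> [/not_orP[h1 h2]|->]; last by rewrite ltxx; case.
by case: (ltrgt0P (meval (fun i => x ord0 i) p)) h1 h2.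
Qed.

Lemma semialgebraic_bigcap n (I : finType) (A : I -> set 'rV[R]_n) :
  (forall i, semialgebraic (A i)) -> semialgebraic [set x | forall i, A i x].
Proof.
move=> Asa.
have : semialgebraic [set x | forall i, i \in enum I -> A i x].
  elim: (enum I) => [|i s IH].
    by apply: semialgebraic_ext (semialgebraicT n).
  apply: semialgebraic_ext (semialgebraic_setI (Asa i) IH) => x /=; split.
    by move=> [Ai As] j; rewrite inE => /orP[/eqP->|/As].
  by move=> h; split => [|j js]; apply: h; rewrite inE ?eqxx ?js ?orbT.
by apply: semialgebraic_ext => x; split=> h i => [|_]; apply: h; rewrite ?mem_enum.
Qed.

Lemma semialgebraic_seq_cup n (T : eqType) (s : seq T) (A : T -> set 'rV[R]_n) :
  (forall i, semialgebraic (A i)) -> semialgebraic [set x | exists2 i, i \in s & A i x].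
Proof.
move=> Asa; elim: s => [|i s IH].
  apply: semialgebraic_ext (semialgebraic_setC (semialgebraicT n)) => x /=.
  by split=> [/(_ Logic.I)|[]].
apply: semialgebraic_ext (semialgebraic_setU (Asa i) IH) => x /=; split.
  by move=> [Ai|[j js Aj]]; [exists i; rewrite ?mem_head|exists j; rewrite ?inE ?js ?orbT].
by move=> [j]; rewrite inE => /orP[/eqP->|js] Aj; [left|right; exists j].
Qed.

Lemma semialgebraic_preim k l (S : set 'rV[R]_k) (phi : 'I_k -> mpoly l R) :
  semialgebraic S -> semialgebraic [set x | S (\row_j mpeval (phi j) x)].
Proof.
elim=> [p|A B _ IA _ IB|A B _ IA _ IB|A _ IA].
- apply: semialgebraic_ext (semialgebraic_pos (mmap (@mpolyC l R) phi p)) => x /=.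
  suff -> : mpeval (mmap (@mpolyC l R) phi p) x = mpeval p (\row_j mpeval (phi j) x) by [].
  move: p; rewrite /mpeval.
  apply: (mpoly_rmorph_ext (f := meval (fun i => x ord0 i) \o mmap (@mpolyC l R) phi)) => [c|j] /=.
    by rewrite mmapC !mevalC.
  by rewrite mmapXU mevalXU mxE.
- exact: semialgebraic_setU IA IB.
- exact: semialgebraic_setI IA IB.
- exact: semialgebraic_setC IA.
Qed.

(** [Ps] consists of the polynomials occurring in a description of [S]. *)
Lemma semialgebraic_sign n (S : set 'rV[R]_n) : semialgebraic S ->
  exists Ps : seq (mpoly n R), forall x x',
   (forall P, P \in Ps -> Num.sg (mpeval P x) = Num.sg (mpeval P x')) -> S x -> S x'.
Proof.
move=> Ssa; suff [Ps h] : exists Ps : seq (mpoly n R), forall x x',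
   (forall P, P \in Ps -> Num.sg (mpeval P x) = Num.sg (mpeval P x')) -> (S x <-> S x').
  by exists Ps => x x' /h[].
elim: Ssa => [p|A B _ [s IA] _ [t IB]|A B _ [s IA] _ [t IB]|A _ [s IA]].
- exists [:: p] => x x' /(_ p (mem_head _ _)) e /=.
  by rewrite -sgr_gt0 e sgr_gt0.
- exists (s ++ t) => x x' h; have {}IA := IA x x'; have {}IB := IB x x'.
  rewrite /setU /= IA ?IB // => P Ps; apply: h; by rewrite mem_cat Ps ?orbT.
- exists (s ++ t) => x x' h; have {}IA := IA x x'; have {}IB := IB x x'.
  rewrite /setI /= IA ?IB // => P Ps; apply: h; by rewrite mem_cat Ps ?orbT.
- by exists s => x x' h; rewrite /setC /= (IA x x').
Qed.

Definition env n (x : 'rV[R]_n) : seq R := [seq x ord0 i | i <- enum 'I_n].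

Lemma nth_env n (x : 'rV[R]_n) (i : 'I_n) : nth 0 (env x) i = x ord0 i.
Proof. by rewrite (nth_map i) ?size_enum_ord // nth_ord_enum. Qed.

Lemma mpoly_term n (p : mpoly n R) : exists t : GRing.term R,
  forall e, GRing.eval e t = meval (fun i : 'I_n => nth 0 e i) p.
Proof.
pose T p := exists t : GRing.term R,
  forall e, GRing.eval e t = meval (fun i : 'I_n => nth 0 e i) p.
have TC c : T (mpolyC n c) by exists (GRing.Const c) => e; rewrite mevalC.
have TX i : T (mX i) by exists (GRing.Var _ i) => e; rewrite mevalXU.
have TD p1 p2 : T p1 -> T p2 -> T (p1 + p2).
  by move=> [t1 h1] [t2 h2]; exists (GRing.Add t1 t2) => e; rewrite mevalD -h1 -h2.
have TM p1 p2 : T p1 -> T p2 -> T (p1 * p2).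
  by move=> [t1 h1] [t2 h2]; exists (GRing.Mul t1 t2) => e; rewrite rmorphM /= -h1 -h2.
have T1 : T 1 by rewrite -mpolyC1.
elim/mpolyind: p => [|c m p _ _ IH]; first by rewrite -mpolyC0; apply: (TC).
rewrite -mul_mpolyC; apply: (TD) => //; apply: (TM) => //.
rewrite mpolyXE_id; apply: (big_ind T T1 TM) => i _.
by elim: (m i) => [|j IHj]; rewrite ?expr0 // exprS; apply: (TM).
Qed.

Lemma term_mpoly n (t : GRing.term R) : GRing.rterm t ->
  exists p : mpoly n R, forall x, GRing.eval (env x) t = mpeval p x.
Proof.
rewrite /mpeval; elim: t => //=.
- move=> i _; have [ltin|lein] := ltnP i n.
    by exists (mX (Ordinal ltin)) => x; rewrite mevalXU -nth_env.
  by exists 0 => x; rewrite meval0 nth_default // size_map size_enum_ord.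
- by move=> c _; exists (mpolyC n c) => x; rewrite mevalC.
- by move=> k _; exists (k%:R) => x; rewrite rmorph_nat.
- by move=> t1 IH1 t2 IH2 /andP[/IH1[p1 h1] /IH2[p2 h2]]; exists (p1 + p2) => x;
    rewrite mevalD h1 h2.
- by move=> t1 IH1 /IH1[p1 h1]; exists (- p1) => x; rewrite mevalN h1.
- by move=> t1 IH1 k /IH1[p1 h1]; exists (p1 *+ k) => x; rewrite mevalMn h1.
- by move=> t1 IH1 t2 IH2 /andP[/IH1[p1 h1] /IH2[p2 h2]]; exists (p1 * p2) => x;
    rewrite rmorphM h1 h2.
- by move=> t1 IH1 k /IH1[p1 h1]; exists (p1 ^+ k) => x; rewrite rmorphXn h1.
Qed.

Lemma semialgebraic_formula n (S : set 'rV[R]_n) : semialgebraic S ->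
  exists phi : oq.formula R, forall e, oq.holds e phi <-> S (\row_(i < n) nth 0 e i).
Proof.
elim=> [p|A B _ [s IA] _ [t IB]|A B _ [s IA] _ [t IB]|A _ [s IA]].
- have [t h] := mpoly_term p; exists (oq.Lt (GRing.NatConst R 0) t) => e /=.
  rewrite h /mpeval; suff -> : meval (fun i : 'I_n => nth 0 e i) p =
    meval (fun i => (\row_(i0 < n) nth 0 e i0) ord0 i) p by [].
  by apply: meval_eq => i; rewrite mxE.
- by exists (oq.Or s t) => e /=; rewrite IA IB.
- by exists (oq.And s t) => e /=; rewrite IA IB.
- by exists (oq.Not s) => e /=; rewrite IA.
Qed.

Lemma formula_semialgebraic n (phi : oq.formula R) : oq.qf_form phi -> oq.rformula phi ->
  semialgebraic [set x : 'rV[R]_n | oq.qf_eval (env x) phi].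
Proof.
have pos t1 t2 : GRing.rterm t1 -> GRing.rterm t2 ->
    semialgebraic [set x : 'rV[R]_n | GRing.eval (env x) t1 < GRing.eval (env x) t2].
  move=> /(@term_mpoly n)[p1 h1] /(@term_mpoly n)[p2 h2].
  apply: semialgebraic_ext (semialgebraic_pos (p2 - p1)) => x /=.
  by rewrite h1 h2 /mpeval mevalB subr_gt0.
elim: phi => //=.
- move=> [] _ _; first exact: semialgebraic_ext (semialgebraicT n).
  apply: semialgebraic_ext (semialgebraic_setC (semialgebraicT n)) => x /=.
  by split=> // /(_ Logic.I).
- move=> t1 t2 _ /andP[r1 r2].
  apply: semialgebraic_ext (semialgebraic_setC (semialgebraic_setU
    (pos _ _ r1 r2) (pos _ _ r2 r1))) => x /=; split.
    by case: ltrgtP => // _ []; [left|right].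
  by move=> /eqP ->; rewrite ltxx; case.
- by move=> t1 t2 _ /andP[r1 r2]; apply: pos.
- move=> t1 t2 _ /andP[r1 r2].
  apply: semialgebraic_ext (semialgebraic_setC (pos _ _ r2 r1)) => x /=.
  by rewrite leNgt; split => /negP.
- move=> f1 IH1 f2 IH2 /andP[q1 q2] /andP[r1 r2].
  apply: semialgebraic_ext (semialgebraic_setI (IH1 q1 r1) (IH2 q2 r2)) => x /=.
  by split => /andP.
- move=> f1 IH1 f2 IH2 /andP[q1 q2] /andP[r1 r2].
  apply: semialgebraic_ext (semialgebraic_setU (IH1 q1 r1) (IH2 q2 r2)) => x /=.
  by split => /orP.
- move=> f1 IH1 f2 IH2 /andP[q1 q2] /andP[r1 r2].
  apply: semialgebraic_ext (semialgebraic_setU (semialgebraic_setC (IH1 q1 r1))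
    (IH2 q2 r2)) => x /=.
  by rewrite implybE; split => [[/negP->//|->]|/orP[/negP|]]; rewrite ?orbT; auto.
- move=> f1 IH1 q1 r1.
  apply: semialgebraic_ext (semialgebraic_setC (IH1 q1 r1)) => x /=.
  by split => /negP.
Qed.

Lemma holds_foldr_exists (phi : oq.formula R) k m e :
  oq.holds e (foldr oq.Exists phi (iota k m)) <->
  exists2 e', (forall j, ~~ (k <= j < k + m)%N -> nth 0 e' j = nth 0 e j) & oq.holds e' phi.
Proof.
elim: m k e => [|m IH] k e /=.
  split=> [h|[e' ee' h]]; first by exists e.
  by apply: oq.eq_holds h => j; rewrite ee' // addn0 ltnNge andbN.
split=> [[x /IH[e' ee' h]]|[e' ee' h]].
  exists e' => // j; rewrite negb_and -ltnNge -leqNgt => jk.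
  rewrite ee' ?nth_set_nth /=; last first.
    rewrite addSnnS negb_and -ltnNge -leqNgt.
    by case/orP: jk => jk; rewrite ?jk ?orbT // ltnS ltnW.
  by case: eqP jk => // ->; rewrite ltnn /= addnS ltnNge leq_addr.
exists (nth 0 e' k); apply/IH; exists e' => // j jk.
rewrite nth_set_nth /=; case: eqP => [->//|/eqP jk'].
apply: ee'; apply: contra jk => /andP[kj jm].
by rewrite addSnnS jm andbT ltn_neqAle eq_sym jk' kj.
Qed.

(** Tarski-Seidenberg: quantifier elimination over real closed fields is applied to the formula of
    [S] with its last [m] variables bound existentially. *)
Lemma semialgebraic_proj k m (S : set 'rV[R]_(k + m)) : semialgebraic S ->
  semialgebraic [set x : 'rV[R]_k | exists y : 'rV[R]_m, S (row_mx x y)].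
Proof.
move=> /semialgebraic_formula[phi phiP].
pose psi := oq.quantifier_elim
  (fun n s => qe_rcf.qfr_to_formula (qe_rcf.wproj (F := R) n s))
  (oq.to_rform (foldr oq.Exists phi (iota k m))).
have /andP[qf rf] : oq.qf_form psi && oq.rformula psi.
  apply: oq.quantifier_elim_wf; first exact: qe_rcf.wf_QE_wproj.
  exact: oq.to_rform_rformula.
apply: semialgebraic_ext (formula_semialgebraic k qf rf) => x /=.
have -> : oq.qf_eval (env x) psi = qe_rcf.rcf_sat (env x) (foldr oq.Exists phi (iota k m)) by [].
split=> [/qe_rcf.rcf_satP/holds_foldr_exists[e' ee' /phiP h]|[y Sxy]].
  exists (\row_(j < m) nth 0 e' (k + j)%N); move: h; set u := \row_i _; set v := row_mx _ _.
  suff -> : u = v by [].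
  apply/rowP => i; rewrite !mxE; case: splitP => j e; last by rewrite mxE e.
  by rewrite e ee' ?nth_env // negb_and -ltnNge ltn_ord.
apply/qe_rcf.rcf_satP/holds_foldr_exists; exists (env (row_mx x y)).
  move=> j; rewrite negb_and -ltnNge -leqNgt; case: (ltnP j k) => [jk _|kj /= kmj].
    have := nth_env (row_mx x y) (lshift m (Ordinal jk)); rewrite /= => ->.
    by rewrite row_mxEl -nth_env.
  by rewrite !nth_default // size_map size_enum_ord.
apply/phiP; set u := \row_i _; suff -> : u = row_mx x y by [].
by apply/rowP => i; rewrite mxE nth_env.
Qed.

End Semialgebraic.

(** * Roots of polynomials and neighborhoods *)

Section NearRoots.
Variable R : rcfType.
Local Notation toC := (complex.real_complex R).

Lemma normc_real (x : R) : `|toC x| = toC `|x|.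
Proof. by rewrite complex.normc_def /= expr0n addr0 sqrtr_sqr. Qed.

(** For real [z] the bound is [d] itself; otherwise the imaginary part of [z] bounds the distance to
    every real point. *)
Lemma normc_subr_ge (z : complex.complex R) (d : R) : 0 < d ->
  exists2 m : R, 0 < m & forall y : R,
    (forall r, z = toC r -> d <= `|y - r|) -> toC m <= `|toC y - z|.
Proof.
case: z => a b d0; have [b0|bn] := eqVneq b 0.
  exists d => // y /(_ a); rewrite b0 => /(_ erefl) h.
  by rewrite -[complex.Complex a 0]/(toC a) -rmorphB normc_real complex.lecR.
exists `|b|; rewrite ?normr_gt0 // => y _.
rewrite complex.normc_def complex.lecR /= -sqrtr_sqr ler_wsqrtr //.
by rewrite sub0r sqrrN lerDr sqr_ge0.
Qed.

(** Over the algebraic closure [p] is a product of linear factors. If [y] keeps distance [d] from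
    the real roots, every factor, and so [p.[y]], is bounded away from 0. *)
Lemma near_root (p : {poly R}) : p != 0 -> exists rs : seq R, forall d, 0 < d ->
  exists2 e : R, 0 < e & forall y, `|p.[y]| < e -> exists2 r, r \in rs & `|y - r| < d.
Proof.
move=> p0; pose pC := map_poly toC p.
have [rs pE] := closed_field_poly_normal pC.
(* The real roots are among the real parts of the complex ones; further entries do no harm. *)
exists (map (@complex.Re R) rs) => d d0.
have [m m0 mP] : exists2 m : R, 0 < m & forall y,
    (forall r, toC r \in rs -> d <= `|y - r|) -> toC m <= \prod_(z <- rs) `|toC y - z|.
  elim: (rs) => [|z s [m m0 IH]]; first by exists 1 => // y _; rewrite big_nil rmorph1.
  have [k k0 kP] := normc_subr_ge z d0.
  exists (k * m) => [|y yr]; first exact: mulr_gt0.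
  have toC_ge0 (u : R) : 0 < u -> 0 <= toC u.
    by move=> u0; rewrite -[0]/(toC 0) complex.lecR ltW.
  rewrite big_cons rmorphM; apply: ler_pM; [exact: toC_ge0|exact: toC_ge0| |].
    by apply: kP => r zr; apply: yr; rewrite -zr mem_head.
  by apply: IH => r rs'; apply: yr; rewrite inE rs' orbT.
exists (`|lead_coef p| * m) => [|y].
  by rewrite mulr_gt0 // normr_gt0 lead_coef_eq0.
apply: contraPP => nex; apply/negP; rewrite -leNgt -complex.lecR -normc_real.
rewrite -horner_map -/pC pE hornerZ horner_prod normrM normr_prod.
have -> : lead_coef pC = toC (lead_coef p) by rewrite lead_coef_map.
rewrite normc_real rmorphM ler_wpM2l ?complex.lecR //.
rewrite [X in _ <= X](eq_bigr (fun z => `|toC y - z|)) => [|z _]; last by rewrite hornerXsubC.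
apply: mP => r rrs; rewrite leNgt; apply/negP => yr; apply: nex; exists r => //.
by apply/mapP; exists (toC r).
Qed.

End NearRoots.

(** * Neighborhoods by coordinate boxes *)

Section Boxes.
Variables (R : rcfType) (n : nat).
Implicit Types (M : set 'rV[R]_n) (q x : 'rV[R]_n) (t : R).

Definition box q t : set 'rV[R]_n := [set x | forall i, `|x ord0 i - q ord0 i| < t].

Lemma nbhs_box q (A : set 'rV[R]_n) :
  nbhs q A <-> exists2 t : R, 0 < t & box q t `<=` A.
Proof.
split=> [/nbhs_ballP[t /= t0 h]|[t t0 h]].
  exists t => // x xq; apply: h; split=> // i j.
  by rewrite ord1 /ball /= distrC; apply: xq.
apply/nbhs_ballP; exists t => //= x [_ xq]; apply: h => i.
by have := xq ord0 i; rewrite /ball /= distrC.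
Qed.

Lemma boxS q s t : s <= t -> box q s `<=` box q t.
Proof. by move=> st x xq i; apply: lt_le_trans (xq i) st. Qed.

Lemma box_refl q t : 0 < t -> box q t q.
Proof. by move=> t0 i; rewrite subrr normr0. Qed.

Lemma box_trans q x y s t : box q s x -> box x t y -> box q (s + t) y.
Proof.
move=> qx xy i; rewrite -(subrK (x ord0 i) (y ord0 i)) -addrA addrC.
by apply: le_lt_trans (ler_normD _ _) _; apply: ltrD.
Qed.

Lemma closure_box M q : closure M q <-> forall t, 0 < t -> exists2 x, M x & box q t x.
Proof.
split=> [Mq t t0|Mq B /nbhs_box[t t0 tB]].
  have [|x [Mx xq]] := Mq (box q t); first by apply/nbhs_box; exists t.
  by exists x.
by have [x Mx xq] := Mq t t0; exists x; split => //; apply: tB.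
Qed.

Lemma within_continuous_box M (f : 'rV[R]_n -> R) :
  {within M, continuous f} <->
  forall p, M p -> forall e, 0 < e -> exists2 t, 0 < t &
    forall x, M x -> box p t x -> `|f x - f p| < e.
Proof.
rewrite subspace_continuousP; split=> h p Mp.
  move=> e e0; have /(_ (ball (f p) e)) := h p Mp.
  case/(_ (nbhsx_ballx _ _ e0))/nbhs_box => t t0 tB.
  by exists t => // x Mx xp; have := tB x xp Mx; rewrite /ball /= distrC.
move=> B /nbhs_ballP[e /= e0 eB]; have [t t0 tP] := h p Mp e e0.
apply/nbhs_box; exists t => // x xp Mx; apply: eB.
by rewrite /ball /= distrC; apply: tP.
Qed.

Lemma mpeval_continuous (P : mpoly n R) q e : 0 < e ->
  exists2 t, 0 < t & forall x, box q t x -> `|mpeval P x - mpeval P q| < e.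
Proof.
pose T P := forall e, 0 < e -> exists2 t, 0 < t & forall x, box q t x ->
  `|meval (fun i => x ord0 i) P - meval (fun i => q ord0 i) P| < e.
rewrite /mpeval.
have TC c : T (mpolyC n c) by move=> d d0; exists 1 => // x _; rewrite !mevalC subrr normr0.
have TX i : T (mX i) by move=> d d0; exists d => // x xq; rewrite !mevalXU.
have TD p1 p2 : T p1 -> T p2 -> T (p1 + p2).
  move=> h1 h2 d d0; have d2 : 0 < d / 2 by rewrite divr_gt0.
  have [t1 t10 h1'] := h1 _ d2; have [t2 t20 h2'] := h2 _ d2.
  exists (Num.min t1 t2) => [|x xq]; first by rewrite lt_min t10.
  rewrite !mevalD opprD addrACA [d]splitr; apply: le_lt_trans (ler_normD _ _) _.
  by apply: ltrD; [apply: h1'|apply: h2']; apply: boxS xq; rewrite ge_min lexx ?orbT.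
have TM p1 p2 : T p1 -> T p2 -> T (p1 * p2).
  move=> h1 h2 d d0; have [B B0 BE] : exists2 B : R, 0 < B & `|meval (fun i => q ord0 i) p2| + 1 <= B.
    by exists (`|meval (fun i => q ord0 i) p2| + 1); rewrite ?ltr_wpDl.
  have [C C0 CE] : exists2 C : R, 0 < C & `|meval (fun i => q ord0 i) p1| + 1 <= C.
    by exists (`|meval (fun i => q ord0 i) p1| + 1); rewrite ?ltr_wpDl.
  have d1 : 0 < d / 2 / B by rewrite !divr_gt0.
  have d2 : 0 < Num.min 1 (d / 2 / C) by rewrite lt_min ltr01 !divr_gt0.
  have [t1 t10 h1'] := h1 _ d1; have [t2 t20 h2'] := h2 _ d2.
  exists (Num.min t1 t2) => [|x xq]; first by rewrite lt_min t10.
  have {}h1' : `|meval (fun i => x ord0 i) p1 - meval (fun i => q ord0 i) p1| < d / 2 / B.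
    by apply: h1'; apply: boxS xq; rewrite ge_min lexx ?orbT.
  have := h2' x; rewrite lt_min => {h2'} h2'.
  have /h2'/andP[h21 h22] : box q t2 x by apply: boxS xq; rewrite ge_min lexx ?orbT.
  rewrite !rmorphM /=; set a := meval _ p1 in h1' *; set b := meval _ p2 in h21 h22 *.
  set a' := meval _ p1 in CE h1' *; set b' := meval _ p2 in BE h21 h22 *.
  have -> : a * b - a' * b' = (a - a') * b + a' * (b - b').
    by rewrite mulrBl mulrBr addrA subrK.
  have bB : `|b| < B.
    rewrite (_ : b = b' + (b - b')); last by rewrite addrC subrK.
    apply: le_lt_trans (ler_normD _ _) _.
    by apply: lt_le_trans BE; rewrite ltrD2l.
  have aC : `|a'| < C by apply: lt_le_trans CE; rewrite ltrDl.
  rewrite [d]splitr; apply: le_lt_trans (ler_normD _ _) _; rewrite !normrM; apply: ltrD.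
    rewrite -[ltRHS](divfK (lt0r_neq0 B0)); apply: le_lt_trans (_ : _ <= `|a - a'| * B) _.
      by rewrite ler_wpM2l // ltW.
    by rewrite ltr_pM2r.
  rewrite -[ltRHS](divfK (lt0r_neq0 C0)) [ltRHS]mulrC.
  apply: le_lt_trans (_ : _ <= C * `|b - b'|) _; first by rewrite ler_wpM2r // ltW.
  by rewrite ltr_pM2l.
have T1 : T 1 by rewrite -mpolyC1.
move: e; elim/mpolyind: P => [|c m p _ _ IH]; first by rewrite -(mpolyC0 n); apply: (TC).
rewrite -mul_mpolyC; apply: (TD) => //; apply: (TM) => //.
rewrite mpolyXE_id; apply: (big_ind T T1 TM) => i _.
by elim: (m i) => [|j IHj]; rewrite ?expr0 // exprS; apply: (TM).
Qed.

Lemma mpeval_sign (P : mpoly n R) q : mpeval P q != 0 ->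
  exists2 t, 0 < t & forall x, box q t x -> Num.sg (mpeval P x) = Num.sg (mpeval P q).
Proof.
move=> Pq; have [|t t0 h] := mpeval_continuous P q (e := `|mpeval P q|); first by rewrite normr_gt0.
exists t => // x /h; case: (ltrgt0P (mpeval P q)) Pq => // s _.
  by rewrite ltr_distl subrr => /andP[/gtr0_sg-> _]; rewrite gtr0_sg.
by rewrite ltr_distl addrN => /andP[_ /ltr0_sg->]; rewrite ltr0_sg.
Qed.

End Boxes.

(** * Semialgebraicity of local boundedness and of the closure *)

Section Bounded.
Variables (R : rcfType) (n : nat).

Lemma graph_onP (M : set 'rV[R]_n) (f : 'rV[R]_n -> R) x (y : R) :
  graph_on M f (row_mx x y%:M) <-> M x /\ y = f x.
Proof.
split=> [[x' Mx' /eq_row_mx[<- e]]|[Mx ->]]; last by exists x.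
by split=> //; move: (congr1 (fun A : 'M_1 => A ord0 ord0) e); rewrite !mxE eqxx !mulr1n.
Qed.

(** Project the part of the graph lying between the heights [r - d] and [r + d]. *)
Lemma semialgebraic_band (M : set 'rV[R]_n) (f : 'rV[R]_n -> R) (r d : R) :
  semialgebraic (graph_on M f) -> semialgebraic [set x | M x /\ `|f x - r| < d].
Proof.
move=> fsa; pose Y : mpoly (n + 1) R := mX (rshift n ord0).
have band : semialgebraic ([set u | 0 < mpeval (mpolyC _ d - (Y - mpolyC _ r)) u]
   `&` [set u | 0 < mpeval (mpolyC _ d + (Y - mpolyC _ r)) u]).
  by apply: semialgebraic_setI; apply: semialgebraic_pos.
apply: semialgebraic_ext (semialgebraic_proj (semialgebraic_setI fsa band)) => x /=.
have YE (y : R) : mpeval Y (row_mx x y%:M) = y.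
  by rewrite /mpeval mevalXU row_mxEr mxE eqxx mulr1n.
have bE (y : R) : (0 < mpeval (mpolyC (n + 1) d - (Y - mpolyC _ r)) (row_mx x y%:M) /\
    0 < mpeval (mpolyC (n + 1) d + (Y - mpolyC _ r)) (row_mx x y%:M)) <-> `|y - r| < d.
  move: (YE y); rewrite /mpeval !(mevalB, mevalD, mevalC) => ->.
  by rewrite ltr_norml; split=> [[h1 h2]|/andP[h1 h2]]; [apply/andP|]; split; lra.
split=> [[y [/= + +]]|[Mx fxr]].
  by rewrite [y]mx11_scalar => /graph_onP[Mx ->] /bE.
by exists (f x)%:M; split; [apply/graph_onP|apply/bE].
Qed.

(** One parameter [t] is both the radius of the box and the inverse of the bound on the fibers, so a
    single existential quantifier is enough. *)
Definition locally_bounded (S : set 'rV[R]_(n + 1)) : set 'rV[R]_n :=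
  [set q | exists2 t : R, 0 < t & forall x (y : R), S (row_mx x y%:M) ->
     box q t x -> `|y * t| < 1].

Lemma semialgebraic_locally_bounded (S : set 'rV[R]_(n + 1)) :
  semialgebraic S -> semialgebraic (locally_bounded S).
Proof.
move=> Ssa; pose m := (n + 1)%N.
pose A j : mpoly (m + m) R := mX (lshift m j).
pose B j : mpoly (m + m) R := mX (rshift m j).
have AE j a b : mpeval (A j) (row_mx a b) = a ord0 j by rewrite /mpeval mevalXU row_mxEl.
have BE j a b : mpeval (B j) (row_mx a b) = b ord0 j by rewrite /mpeval mevalXU row_mxEr.
pose T := A (rshift n ord0).
pose D (i : 'I_n) := B (lshift 1 i) - A (lshift 1 i).
(* The counterexamples: with [(q, t)] in the first block and [(x, y)] in the second, [x] is in the
   box and the bound fails. Projecting and complementing expresses the universal quantifier; a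
   second projection eliminates [t]. *)
pose S1 : set 'rV[R]_(m + m) := [set u | S (\row_j mpeval (B j) u)]
  `&` ([set u | forall i, 0 < mpeval (T - D i) u] `&` ([set u | forall i, 0 < mpeval (T + D i) u]
  `&` ~` [set u | 0 < mpeval (1 - (B (rshift n ord0) * T) ^+ 2) u])).
have S1sa : semialgebraic S1.
  apply: semialgebraic_setI; first exact: semialgebraic_preim.
  apply: semialgebraic_setI.
    by apply: semialgebraic_bigcap => i; apply: semialgebraic_pos.
  apply: semialgebraic_setI.
    by apply: semialgebraic_bigcap => i; apply: semialgebraic_pos.
  by apply: semialgebraic_setC; apply: semialgebraic_pos.
have S1E q (t : R) x (y : R) : S1 (row_mx (row_mx q t%:M) (row_mx x y%:M)) <->
    [/\ S (row_mx x y%:M), box q t x & ~ `|y * t| < 1].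
  rewrite /S1 /setI /=.
  have -> : \row_j mpeval (B j) (row_mx (row_mx q t%:M) (row_mx x y%:M)) = row_mx x y%:M.
    by apply/rowP => j; rewrite mxE BE.
  have TE : mpeval T (row_mx (row_mx q t%:M) (row_mx x y%:M)) = t.
    by rewrite AE row_mxEr mxE eqxx mulr1n.
  have DE i : mpeval (D i) (row_mx (row_mx q t%:M) (row_mx x y%:M)) = x ord0 i - q ord0 i.
    by move: (AE (lshift 1 i)) (BE (lshift 1 i)); rewrite /mpeval mevalB => -> ->;
      rewrite !row_mxEl.
  have YE : mpeval (B (rshift n ord0)) (row_mx (row_mx q t%:M) (row_mx x y%:M)) = y.
    by rewrite BE row_mxEr mxE eqxx mulr1n.
  have -> : (forall i, 0 < mpeval (T - D i) (row_mx (row_mx q t%:M) (row_mx x y%:M))) <->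
      (forall i, x ord0 i - q ord0 i < t).
    by split=> h i; have := h i; move: TE (DE i); rewrite /mpeval mevalB => -> ->; rewrite subr_gt0.
  have -> : (forall i, 0 < mpeval (T + D i) (row_mx (row_mx q t%:M) (row_mx x y%:M))) <->
      (forall i, - t < x ord0 i - q ord0 i).
    by split=> h i; have := h i; move: TE (DE i); rewrite /mpeval mevalD => -> ->; lra.
  have -> : (0 < mpeval (1 - (B (rshift n ord0) * T) ^+ 2)
      (row_mx (row_mx q t%:M) (row_mx x y%:M))) = (`|y * t| < 1).
    move: TE YE; rewrite /mpeval mevalB rmorphXn /= meval1 mevalM => -> ->.
    by rewrite subr_gt0 -real_normK ?num_real // expr_lt1.
  split=> [[h1 [h2 [h3 h4]]]|[h1 h2 h3]].
    by split=> // i; rewrite ltr_norml h2 h3.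
  split=> //; split; [|split=> //] => i; have := h2 i; rewrite ltr_norml => /andP[] //.
have S2sa := semialgebraic_setI (semialgebraic_pos (mX (rshift n ord0) : mpoly m R))
   (semialgebraic_setC (semialgebraic_proj S1sa)).
apply: semialgebraic_ext (semialgebraic_proj S2sa) => q /=; split.
  move=> [t [/=]]; rewrite [t]mx11_scalar; set t' := t ord0 ord0.
  rewrite /mpeval mevalXU row_mxEr mxE eqxx mulr1n => t0 h; exists t' => // x y Sxy qx.
  by apply: contrapT => nyt; apply: h; exists (row_mx x y%:M); apply/S1E.
move=> [t t0 h]; exists t%:M; split=> /=.
  by rewrite /mpeval mevalXU row_mxEr mxE eqxx mulr1n.
move=> [u uS]; have uE : u = row_mx (lsubmx u) (rsubmx u ord0 ord0)%:M.
  by rewrite -mx11_scalar hsubmxK.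
by move: uS; rewrite uE => /S1E[Sxy qx ny]; apply: ny; apply: h Sxy qx.
Qed.

(** Apply local boundedness to the cylinder over [M]: its fibers over [M] are whole lines, so it is
    locally bounded at [q] exactly when [q] is not in the closure. *)
Lemma semialgebraic_closure (M : set 'rV[R]_n) : semialgebraic M -> semialgebraic (closure M).
Proof.
move=> Msa; pose S : set 'rV[R]_(n + 1) := [set u | M (\row_j mpeval (mX (lshift 1 j) : mpoly _ R) u)].
have Ssa : semialgebraic S by apply: semialgebraic_preim.
have SE x (y : R) : S (row_mx x y%:M) <-> M x.
  rewrite /S /=; suff -> : \row_j mpeval (mX (lshift 1 j) : mpoly (n + 1) R) (row_mx x y%:M) = x by [].
  by apply/rowP => j; rewrite mxE /mpeval mevalXU row_mxEl.
apply: semialgebraic_ext (semialgebraic_setC (semialgebraic_locally_bounded Ssa)) => q /=.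
split=> [h|/closure_box h].
  apply/closure_box => t t0; apply: contrapT => nex; apply: h; exists t => // x y /SE Mx qx.
  by case: nex; exists x.
move=> [t t0 tS]; have [x Mx qx] := h t t0.
by have := tS x t^-1 ((SE _ _).2 Mx) qx; rewrite mulVf ?lt0r_neq0 // normr1 ltxx.
Qed.

Lemma locally_bounded_nbhs (S : set 'rV[R]_(n + 1)) q :
  locally_bounded S q -> nbhs q (locally_bounded S).
Proof.
move=> [t t0 h]; have t2 : 0 < t / 2 by rewrite divr_gt0.
apply/nbhs_box; exists (t / 2) => // q' qq'; exists (t / 2) => // x y Sxy q'x.
have := h x y Sxy; rewrite [t in box _ t]splitr => /(_ (box_trans qq' q'x)).
apply: le_lt_trans; rewrite !(normrM y) ler_wpM2l // ger0_norm ?ltW // ger0_norm ?ltW //.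
by lra.
Qed.

End Bounded.

(** * Common radii and uniform estimates *)

Section Radii.
Variable R : rcfType.

Lemma common_radius (T : eqType) (s : seq T) (P : T -> R -> Prop) :
  (forall a t t', t' <= t -> P a t -> P a t') ->
  (forall a, a \in s -> exists2 t, 0 < t & P a t) ->
  exists2 t, 0 < t & forall a, a \in s -> P a t.
Proof.
move=> Pmon; elim: s => [|a s IH] h; first by exists 1.
have [|t t0 tP] := IH; first by move=> b bs; apply: h; rewrite inE bs orbT.
have [t' t'0 t'P] := h a (mem_head _ _).
exists (Num.min t t') => [|b]; first by rewrite lt_min t0.
rewrite inE => /orP[/eqP->|/tP]; first by apply: Pmon t'P; rewrite ge_min lexx orbT.
by apply: Pmon; rewrite ge_min lexx.
Qed.

Lemma isolated_point (rs : seq R) (v : R) :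
  exists2 d, 0 < d & forall r, r \in rs -> `|r - v| < d -> r = v.
Proof.
apply: common_radius => [a t t' tt' h ht'|a _]; first by apply: h; apply: lt_le_trans tt'.
have [->|av] := eqVneq a v; first by exists 1.
by exists `|a - v|; rewrite ?normr_gt0 ?subr_eq0 // ltxx.
Qed.

Lemma separated_points (rs : seq R) :
  exists2 d, 0 < d & forall r r', r \in rs -> r' \in rs -> `|r - r'| < d + d -> r = r'.
Proof.
have [d d0 h] : exists2 d, 0 < d & forall v, v \in rs -> forall r, r \in rs -> `|r - v| < d -> r = v.
  apply: common_radius => [a t t' tt' h r rrs ht'|a _]; last exact: isolated_point.
  by apply: h => //; apply: lt_le_trans tt'.
exists (d / 2) => [|r r' rr rr']; first by rewrite divr_gt0.
by rewrite -splitr; apply: h.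
Qed.

Lemma isolated_root (e : {poly R}) (v : R) : e != 0 ->
  exists2 d, 0 < d & forall s, e.[s] = 0 -> `|s - v| < d -> s = v.
Proof.
move=> /near_root[rs rsP]; have [d d0 h] := isolated_point rs v; exists d => // s es.
(* The list [rs] contains every root [s]: it has entries arbitrarily close to [s] and is finite. *)
apply: h; have [c c0 cP] := isolated_point rs s.
have [k k0 /(_ s)] := rsP c c0; rewrite es normr0 => /(_ k0)[r rrs sr].
by rewrite -(cP r rrs) // distrC.
Qed.

(** Uniformity in [y] comes from induction along Horner's scheme rather than from compactness. *)
Lemma poly_family_continuous n (H : {poly mpoly n R}) q (B e : R) : 0 < e -> 0 <= B ->
  exists2 t, 0 < t & forall x y, box q t x -> `|y| <= B ->
   `|(map_poly (meval (fun i => x ord0 i)) H).[y] - (map_poly (meval (fun i => q ord0 i)) H).[y]| < e.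
Proof.
move=> e0 B0; elim/poly_ind: H e e0 => [|H c IH] e e0.
  by exists 1 => // x y _ _; rewrite !rmorph0 !horner0 subrr normr0.
have B1 : 0 < B + 1 by rewrite ltr_wpDl.
have [|t t0 h] := IH (e / 2 / (B + 1)); first by rewrite !divr_gt0.
have [|u u0 k] := mpeval_continuous c q (e := e / 2); first by rewrite divr_gt0.
exists (Num.min t u) => [|x y qx yB]; first by rewrite lt_min t0.
rewrite !rmorphD !rmorphM /= !map_polyX !map_polyC !hornerE /= opprD addrACA -mulrBl.
have qxt : box q t x by apply: boxS qx; rewrite ge_min lexx.
have qxu : box q u x by apply: boxS qx; rewrite ge_min lexx orbT.
rewrite [e]splitr; apply: le_lt_trans (ler_normD _ _) _; apply: ltrD; last exact: k.
rewrite normrM; move: (h x y qxt yB); set D := (X in `|X|) => {}h.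
rewrite -[ltRHS](divfK (lt0r_neq0 B1)); apply: (@le_lt_trans _ _ (`|D| * (B + 1))).
  by rewrite ler_wpM2l // (le_trans yB) // lerDl.
by rewrite ltr_pM2r.
Qed.

End Radii.

(** * Limits at frontier points *)

Section Extension.
Variables (R : rcfType) (n : nat) (M : set 'rV[R]_n) (f : 'rV[R]_n -> R).

(** Otherwise no polynomial of [Fs] changes sign on a short vertical segment through [(x, f x)], and
    the graph would contain a second point above [x]. *)
Lemma graph_algebraic (Fs : seq (mpoly (n + 1) R)) :
  (forall u u', (forall F, F \in Fs -> Num.sg (mpeval F u) = Num.sg (mpeval F u')) ->
     graph_on M f u -> graph_on M f u') ->
  forall x, M x -> exists2 F, F \in Fs &
     mpeval F (row_mx x (f x)%:M) = 0 /\ exists y, mpeval F (row_mx x y%:M) <> 0.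
Proof.
move=> Fsgn x Mx; apply: contrapT => nex.
have [t t0 tP] : exists2 t, 0 < t & forall F, F \in Fs -> forall y, `|y - f x| < t ->
    Num.sg (mpeval F (row_mx x y%:M)) = Num.sg (mpeval F (row_mx x (f x)%:M)).
  apply: common_radius => [F t t' tt' h y ht'|F FFs]; first by apply: h; apply: lt_le_trans tt'.
  have [F0|Fn] := eqVneq (mpeval F (row_mx x (f x)%:M)) 0.
    exists 1 => // y _; rewrite F0; apply: contrapT => Fy; apply: nex; exists F => //.
    by split=> //; exists y => Fy0; apply: Fy; rewrite Fy0.
  have [t t0 h] := mpeval_sign Fn; exists t => // y yt; apply: h => i; rewrite !mxE.
  by case: splitP => j _; rewrite ?subrr ?normr0 // !mxE [j]ord1 eqxx !mulr1n.
have : graph_on M f (row_mx x (f x + t / 2)%:M).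
  apply: Fsgn (_ : graph_on M f (row_mx x (f x)%:M)); last exact/graph_onP.
  by move=> F FFs; symmetry; apply: tP => //; rewrite ltr_norml; apply/andP; split; lra.
by move=> /graph_onP[_]; lra.
Qed.

(** [Q(x_i, y, G)] as a polynomial in [y] whose coefficients are polynomials in the coordinates. *)
Definition substXG (i : 'I_n) (G : mpoly n R) (Q : {poly {poly {poly R}}}) : {poly mpoly n R} :=
  (map_poly (map_poly (horner_eval (mX i) \o map_poly (@mpolyC n R))) Q).[G%:P].

Lemma substXG_eval i G Q (x : 'rV[R]_n) (y : R) :
  (map_poly (meval (fun j => x ord0 j)) (substXG i G Q)).[y] = eval3 Q (x ord0 i) y (mpeval G x).
Proof.
set s := x ord0 i; set z := mpeval G x.
pose ev : {rmorphism {poly mpoly n R} -> {poly R}} := map_poly (meval (fun j => x ord0 j)).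
have evG : ev G%:P = z%:P by rewrite /ev /= map_polyC.
rewrite -[map_poly _ _]/(ev (substXG i G Q)) /substXG -(horner_map ev) evG -map_poly_comp /ev /=.
have -> : map_poly (map_poly (meval (fun j => x ord0 j)) \o
    map_poly (horner_eval (mX i) \o map_poly (@mpolyC n R))) Q = map_poly (map_poly (horner_eval s)) Q.
  apply: eq_map_poly => c /=; rewrite -map_poly_comp; apply: eq_map_poly => d /=.
  rewrite /horner_eval -horner_map /= mevalXU -map_poly_comp; congr (_.[_]).
  by rewrite map_poly_id // => u _ /=; rewrite mevalC.
have -> : z%:P = map_poly (horner_eval s) z%:P%:P.
  by rewrite map_polyC /= /horner_eval hornerC.
rewrite horner_map /=.
rewrite [y in LHS](_ : y = horner_eval s y%:P); last by rewrite /horner_eval hornerC.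
by rewrite horner_map.
Qed.

Lemma eval3M P Q (s y z : R) : eval3 (P * Q) s y z = eval3 P s y z * eval3 Q s y z.
Proof. by rewrite /eval3 !hornerM. Qed.

(** Divide [P] by the largest power of its outermost variable; that power is invertible where [z] is
    nonzero. *)
Lemma eval3_factor (P : {poly {poly {poly R}}}) : P != 0 -> exists2 Q, Q.[0] != 0 &
  forall s y z, z != 0 -> eval3 P s y z = 0 -> eval3 Q s y z = 0.
Proof.
move=> P0; have [m [Q]] := multiplicity_XsubC P 0; rewrite P0 /= => Q0 ->.
exists Q => [|s y z z0]; first by rewrite -rootE.
rewrite eval3M => /eqP; rewrite mulf_eq0 => /orP[/eqP->//|].
by rewrite /eval3 subr0 !(horner_exp, hornerX, hornerC) expf_eq0 (negPf z0) andbF.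
Qed.

(* A point of the frontier and a nearby point of [M] differ in the sign of some
   polynomial defining [M]; that polynomial must vanish at the frontier point. *)
Lemma frontier_vanishing (Ps : seq (mpoly n R)) q :
  (forall x x', (forall P, P \in Ps -> Num.sg (mpeval P x) = Num.sg (mpeval P x')) ->
     M x -> M x') -> ~ M q ->
  exists2 t, 0 < t & forall x, M x -> box q t x ->
    exists P, [/\ P \in Ps, mpeval P q = 0 & mpeval P x != 0].
Proof.
move=> Psgn nMq.
have [t t0 tP] : exists2 t, 0 < t & forall P, P \in Ps -> forall x, box q t x ->
    mpeval P q != 0 -> Num.sg (mpeval P x) = Num.sg (mpeval P q).
  apply: common_radius => [P t t' tt' h x qx Pq|P _].
    by apply: h => //; apply: boxS qx.
  have [Pq|Pn] := eqVneq (mpeval P q) 0; first by exists 1.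
  by have [t t0 h] := mpeval_sign Pn; exists t => // x qx _; apply: h.
exists t => // x Mx qx; apply: contrapT => nex; apply: nMq.
apply: Psgn Mx => P PPs; have [Pq|Pn] := eqVneq (mpeval P q) 0; last exact: tP.
rewrite Pq; have [->//|Px] := eqVneq (mpeval P x) 0.
by case: nex; exists P.
Qed.

Lemma open_in_local (S A : set 'rV[R]_n) : A `<=` S ->
  (forall x, A x -> exists2 t, 0 < t & forall y, S y -> box x t y -> A y) -> open_in S A.
Proof.
move=> AS loc; exists (interior [set y | S y -> A y]); first exact: open_interior.
apply/seteqP; split=> [x Ax|x [Sx /interior_subset]]; last by apply.
split; first exact: AS.
by have [t t0 tA] := loc x Ax; apply/nbhs_box; exists t => // y xy Sy; apply: tA.
Qed.

(** If [q] lies in [M] it is among the tested points, which forces [l = f q]. *)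
Definition has_limit q (l : R) : Prop := forall e, 0 < e ->
  exists2 t, 0 < t & forall x, M x -> box q t x -> `|f x - l| < e.

(** Near [q] the set [M] is covered by disjoint bands around the points of [rs]; connectedness of
    the germ leaves only one of them. *)
Lemma finite_cluster_limit q (rs : seq R) :
  semialgebraic_fun M f -> closure M q -> germ_semialgebraically_connected M q ->
  semialgebraic M ->
  (forall d, 0 < d -> exists2 t, 0 < t & forall x, M x -> box q t x ->
     exists2 r, r \in rs & `|f x - r| < d) ->
  exists l, has_limit q l.
Proof.
move=> [fcont fsa] Mq germ Msa near.
have [d d0 sep] := separated_points rs.
have uniq_near x r r' : r \in rs -> r' \in rs -> `|f x - r| < d -> `|f x - r'| < d -> r = r'.
  move=> rrs rrs' h h'; apply: sep => //; rewrite -(subrK (f x) r) -addrA.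
  by apply: le_lt_trans (ler_normD _ _) _; rewrite distrC ltrD.
have [t t0 tP] := near d d0.
have [|W [Wop Wsa Wq WU Wconn]] := germ (box q t); first by apply/nbhs_box; exists t.
have /nbhs_box[u u0 uW] : nbhs q W by apply: open_nbhs_nbhs.
have [x0 Mx0 /uW Wx0] := (closure_box M q).1 Mq u u0.
have [r0 r0rs fx0] := tP x0 Mx0 (WU _ Wx0).
(* By the choice of [d] these sets are disjoint. Both are semialgebraic and relatively open, and
   together they make up [M] inside [W]. *)
pose A := [set x | (M x /\ `|f x - r0| < d) /\ W x].
pose B := [set x | (exists2 r, r \in [seq r <- rs | r != r0] & M x /\ `|f x - r| < d) /\ W x].
have near_open x r : M x -> `|f x - r| < d ->
    exists2 k, 0 < k & forall y, M y -> box x k y -> `|f y - r| < d.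
  move=> Mx fxr; have e0 : 0 < d - `|f x - r| by rewrite subr_gt0.
  have [k k0 h] := (within_continuous_box M f).1 fcont x Mx _ e0.
  exists k => // y My xy; rewrite -(subrK (f x) (f y)) -addrA.
  by apply: le_lt_trans (ler_normD _ _) _; rewrite -ltrBrDr; apply: h.
have : A = set0 \/ B = set0.
  apply: Wconn.
  - by apply: semialgebraic_setI => //; apply: semialgebraic_band.
  - apply: semialgebraic_setI => //.
    by apply: semialgebraic_seq_cup => r; apply: semialgebraic_band.
  - apply: open_in_local => [x [[Mx _] Wx] //|x [[Mx fx] _]].
    have [k k0 h] := near_open x r0 Mx fx; exists k => // y [My Wy] xy.
    by split=> //; split=> //; apply: h.
  - apply: open_in_local => [x [[r _ [Mx _]] Wx] //|x [[r rrs [Mx fx]] _]].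
    have [k k0 h] := near_open x r Mx fx; exists k => // y [My Wy] xy.
    by split=> //; exists r => //; split=> //; apply: h.
  - apply/seteqP; split=> x //= [[[Mx fx] _] [[r + [_ fx']] _]].
    rewrite mem_filter => /andP[/eqP rn rrs]; apply: rn.
    exact: uniq_near fx' fx.
  - apply/seteqP; split=> x [].
      by move=> [[Mx _] Wx].
      by move=> [[r _ [Mx _]] Wx].
    move=> Mx Wx; have [r rrs fx] := tP x Mx (WU _ Wx).
    have [e|rn] := eqVneq r r0; [left|right]; split => //; first by rewrite -e.
    by exists r => //; rewrite mem_filter rn.
case=> [A0|B0]; first by have : A x0 by []; rewrite A0.
(* Within [Num.min d e], closeness to another entry of [rs] would put the point into the empty set
   [B]. *)
exists r0 => e e0; have de : 0 < Num.min d e by rewrite lt_min d0.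
have [k k0 kP] := near _ de.
exists (Num.min k u) => [|x Mx qx]; first by rewrite lt_min k0.
have [|r rrs] := kP x Mx; first by apply: boxS qx; rewrite ge_min lexx.
rewrite lt_min => /andP[fxd fxe].
have Wx : W x by apply: uW; apply: boxS qx; rewrite ge_min lexx orbT.
have [<-//|rn] := eqVneq r r0.
have : B x by split=> //; exists r => //; rewrite mem_filter rn.
by rewrite B0.
Qed.

End Extension.

Section Frontier.
Variables (R : rcfType) (n : nat) (M : set 'rV[R]_n) (f : 'rV[R]_n -> R).

Lemma frontier_near_roots (Ps : seq (mpoly n R)) (i : 'I_n)
    (Q : mpoly n R -> {poly {poly {poly R}}}) (q : 'rV[R]_n) (t0 B : R) :
  (forall x x', (forall P, P \in Ps -> Num.sg (mpeval P x) = Num.sg (mpeval P x')) ->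
     M x -> M x') ->
  (forall G x, G \in Ps -> M x -> mpeval G x != 0 ->
     eval3 (Q G) (x ord0 i) (f x) (mpeval G x) = 0) ->
  (forall G, G \in Ps -> (lead_coef (Q G).[0]).[q ord0 i] != 0) ->
  ~ M q -> 0 < t0 -> (forall x, M x -> box q t0 x -> `|f x| <= B) ->
  exists rs : seq R, forall d, 0 < d -> exists2 t, 0 < t & forall x, M x -> box q t x ->
     exists2 r, r \in rs & `|f x - r| < d.
Proof.
move=> Psgn Q0 Qlead nMq t00 fB; set s := q ord0 i in Qlead.
(* This is [Q(q_i, y, 0)], nonzero because the leading coefficient of [(Q G).[0]] does not vanish at
   [q_i]. *)
pose p G := map_poly (horner_eval s) (Q G).[0].
have pE G y : (p G).[y] = eval3 (Q G) s y 0.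
  rewrite [y in LHS](_ : y = horner_eval s y%:P); last by rewrite /horner_eval hornerC.
  by rewrite horner_map.
have p0 G : G \in Ps -> p G != 0.
  move=> /Qlead; apply: contra_neq => pG0.
  have : (p G)`_(size (Q G).[0]).-1 = 0 by rewrite pG0 coef0.
  by rewrite coef_map.
have rsex G : exists rs : seq R, G \in Ps -> forall d, 0 < d ->
  exists2 e : R, 0 < e & forall y, `|(p G).[y]| < e -> exists2 r, r \in rs & `|y - r| < d.
  have [GPs|] := boolP (G \in Ps); last by exists [::].
  by have [rs h] := near_root (p0 G GPs); exists rs.
have [rs rsP] := choice rsex.
exists (flatten [seq rs G | G <- Ps]) => d d0.
have [t1 t10 front] := frontier_vanishing Psgn nMq.
have B0 : 0 <= Num.max B 0 by rewrite le_max lexx orbT.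
have [t2 t20 near] : exists2 t, 0 < t & forall G, G \in Ps -> mpeval G q = 0 ->
    forall x, M x -> box q t x -> `|f x| <= B -> mpeval G x != 0 ->
    exists2 r, r \in rs G & `|f x - r| < d.
  apply: common_radius => [G t t' tt' h Gq x Mx qx|G GPs].
    by apply: h => //; apply: boxS qx.
  have [e e0 eP] := rsP G GPs d d0.
  (* Compares [Q(x_i, f x, G x)], which is 0, with [Q(q_i, f x, 0)]. *)
  have [t t0' tP] := poly_family_continuous (substXG i G (Q G)) q e0 B0.
  exists t => // Gq x Mx qx fxB Gx; apply: eP.
  have := tP x (f x) qx; rewrite !substXG_eval Gq -/s (Q0 G x GPs Mx Gx) sub0r normrN -pE.
  by apply; rewrite le_max fxB.
exists (Num.min t0 (Num.min t1 t2)) => [|x Mx qx]; first by rewrite !lt_min t00 t10.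
have [|G [GPs Gq Gx]] := front x Mx; first by apply: boxS qx; rewrite !ge_min lexx orbT.
have [||r rrs fxr] := near G GPs Gq x Mx _ _ Gx.
- by apply: boxS qx; rewrite !ge_min lexx !orbT.
- by apply: fB => //; apply: boxS qx; rewrite ge_min lexx.
by exists r => //; apply/flatten_mapP; exists G.
Qed.

End Frontier.

(** * Extension of [f] by its limits *)

Theorem corollary6 (R : rcfType) (n : nat) (M : set 'rV[R]_n)
    (M_semialg : semialgebraic M)
    (M_dim2 : semialgebraic_dim M 2)
    (M_germs : forall q : 'rV[R]_n,
       closure M q -> germ_semialgebraically_connected M q)
    (f : 'rV[R]_n -> R) (f_semialg : semialgebraic_fun M f) :
  exists V : set 'rV[R]_n,
    [/\ semialgebraic V, open_in (closure M) V, M `<=` V &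
        exists g : 'rV[R]_n -> R,
          {within V, continuous g} /\ (forall x, M x -> g x = f x)].
Proof.
have [fcont fsa] := f_semialg.
have [Ps Psgn] := semialgebraic_sign M_semialg.
have [Fs Fsgn] := semialgebraic_sign fsa.
have dep := dim2_dependence M_dim2.2 (graph_algebraic Fsgn).
have Qex (iG : 'I_n * mpoly n R) : exists Q : {poly {poly {poly R}}},
    Q.[0] != 0 /\ forall x, M x -> mpeval iG.2 x != 0 ->
      eval3 Q (x ord0 iG.1) (f x) (mpeval iG.2 x) = 0.
  case: iG => i G; have [P P0 PM] := dep i G.
  have [Q Q0 QP] := eval3_factor P0; exists Q; split=> // x Mx Gx.
  by apply: QP => //; apply: PM.
have [Q QP] := choice Qex.
(* Away from the roots of [e i], [Q(s, y, 0)] is a nonzero polynomial in [y] for every [G] in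
   [Ps]. *)
pose e i : {poly R} := \prod_(G <- Ps) lead_coef (Q (i, G)).[0].
have e0 i : e i != 0.
  by rewrite prodf_seq_neq0; apply/allP => G _ /=; rewrite lead_coef_eq0; case: (QP (i, G)).
pose E := [set q : 'rV[R]_n | forall i, (e i).[q ord0 i] = 0].
pose U := locally_bounded (graph_on M f).
have limP q : closure M q -> U q -> ~ (E q /\ ~ M q) -> exists l, has_limit M f q l.
  move=> Mq [t t0 Ut] nE; have [Mq'|nMq] := pselect (M q).
    by exists (f q) => d d0; apply: (within_continuous_box M f).1.
  have /existsNP[i /eqP ei] : ~ E q by move=> Eq; apply: nE.
  have fB x : M x -> box q t x -> `|f x| <= t^-1.
    move=> Mx qx; have := Ut x (f x) ((graph_onP _ _ _ _).2 (conj Mx erefl)) qx.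
    by rewrite normrM (gtr0_norm t0) -ltr_pdivlMr // div1r => /ltW.
  have [|G GPs|rs rsP] := @frontier_near_roots R n M f Ps i (fun G => Q (i, G)) q t _ Psgn _ _ nMq t0 fB.
  - by move=> G x GPs; apply: (QP (i, G)).2.
  - by move: ei; rewrite /e horner_prod prodf_seq_neq0 => /allP/(_ G GPs).
  exact: finite_cluster_limit f_semialg Mq (M_germs q Mq) M_semialg rsP.
(* From the closure, the points where [f] is not locally bounded and the points of [E] outside [M]
   are removed. *)
pose V := closure M `&` (U `&` ~` (E `&` ~` M)).
have Esa : semialgebraic E.
  apply: semialgebraic_bigcap => i.
  apply: semialgebraic_ext (semialgebraic_zero (map_poly (@mpolyC n R) (e i)).[mX i]) => q /=.
  rewrite /mpeval -horner_map /= mevalXU -map_poly_comp map_poly_id // => c _ /=.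
  by rewrite mevalC.
have VM : M `<=` V.
  move=> p Mp; split; first exact: subset_closure.
  split; last by case.
  have [t t0 tP] := (within_continuous_box M f).1 fcont p Mp 1 ltr01.
  pose B := `|f p| + 1; have B0 : 0 < B by rewrite ltr_wpDl.
  exists (Num.min t B^-1) => [|x y]; first by rewrite lt_min t0 invr_gt0.
  move=> /graph_onP[Mx ->] px.
  have fx : `|f x| < B.
    rewrite -(subrK (f p) (f x)) addrC; apply: le_lt_trans (ler_normD _ _) _.
    by rewrite ltrD2l; apply: tP => //; apply: boxS px; rewrite ge_min lexx.
  have m0 : 0 < Num.min t B^-1 by rewrite lt_min t0 invr_gt0.
  rewrite normrM (gtr0_norm m0); apply: (@lt_le_trans _ _ (B * Num.min t B^-1)).
    by rewrite ltr_pM2r.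
  by rewrite -[leRHS](mulfV (lt0r_neq0 B0)) ler_pM2l // ge_min lexx orbT.
have gex q : exists l, V q -> has_limit M f q l.
  have [[Mq [Uq nE]]|] := pselect (V q); last by exists 0.
  by have [l lP] := limP q Mq Uq nE; exists l.
have [g gP] := choice gex.
exists V; split=> //.
- apply: semialgebraic_setI; first exact: semialgebraic_closure.
  apply: semialgebraic_setI; first exact: semialgebraic_locally_bounded.
  by do ?[apply: semialgebraic_setC|apply: semialgebraic_setI].
- apply: open_in_local => [q [] //|q [Mq [Uq nE]]].
  have /nbhs_box[t t0 tU] := locally_bounded_nbhs Uq.
  (* Outside [E] some [e i] keeps its sign nearby. A point of [E] in [V] belongs to [M] and is
     isolated in [E], as roots are isolated. *)
  have [u u0 uE] : exists2 u, 0 < u & forall y, box q u y -> ~ (E `&` ~` M) y.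
    have [nEq|Eq] := pselect (~ E q).
      have /existsNP[i /eqP ei] := nEq.
      pose P := (map_poly (@mpolyC n R) (e i)).[mX i].
      have PE x : mpeval P x = (e i).[x ord0 i].
        rewrite /mpeval -horner_map /= mevalXU -map_poly_comp map_poly_id // => c _ /=.
        by rewrite mevalC.
      have [|u u0 uP] := @mpeval_sign R n P q; first by rewrite PE.
      exists u => // y qy [Ey _]; have := uP y qy; rewrite !PE (Ey i) sgr0 => /esym/eqP.
      by rewrite sgr_eq0 (negPf ei).
    have Mq' : M q by apply: contrapT => nMq; apply: nE; split=> //; apply: contrapT.
    have [u u0 uP] : exists2 u, 0 < u & forall i, i \in enum 'I_n -> forall s,
        (e i).[s] = 0 -> `|s - q ord0 i| < u -> s = q ord0 i.
      apply: common_radius => [i u u' uu' h s es su|i _]; last exact: isolated_root.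
      by apply: h => //; apply: lt_le_trans uu'.
    exists u => // y qy [Ey]; suff -> : y = q by [].
    by apply/rowP => i; rewrite -[0]/ord0; apply: uP (qy i) => //; rewrite mem_enum.
  exists (Num.min t u) => [|y My qy]; first by rewrite lt_min t0.
  split=> //; split; first by apply: tU; apply: boxS qy; rewrite ge_min lexx.
  by apply: uE; apply: boxS qy; rewrite ge_min lexx orbT.
exists g; split.
  apply/within_continuous_box => v Vv d d0; have d2 : 0 < d / 2 by rewrite divr_gt0.
  have [t t0 tP] := gP v Vv _ d2; have t2 : 0 < t / 2 by rewrite divr_gt0.
  exists (t / 2) => // w Vw vw; have [u u0 uP] := gP w Vw _ d2.
  (* A point [x] of [M] close to [w] is also close to [v], so [f x] approximates both [g w] and
     [g v]. *)
  have [|x Mx wx] := (closure_box M w).1 Vw.1 (Num.min u (t / 2)); first by rewrite lt_min u0.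
  have h1 : `|f x - g w| < d / 2.
    by apply: uP => //; apply: boxS wx; rewrite ge_min lexx.
  have h2 : `|f x - g v| < d / 2.
    apply: tP => //; rewrite [t]splitr; apply: box_trans vw _.
    by apply: boxS wx; rewrite ge_min lexx orbT.
  rewrite -(subrK (f x) (g w)) -addrA [d]splitr; apply: le_lt_trans (ler_normD _ _) _.
  by rewrite distrC ltrD.
(* The limit at a point of [M] is tested at that point itself. *)
move=> x Mx; apply/eqP; rewrite eq_sym -subr_eq0 -normr_eq0 -[_ == 0]negbK.
rewrite -normr_gt0 normr_id; apply/negP => h.
have [t t0 /(_ x Mx (box_refl x t0))] := gP x (VM x Mx) _ h.
by rewrite ltxx.
Qed.
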